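(* Let $\{H_\Lambda\}$ be a thermodynamically stable Gaussian spin-glass Hamiltonian (see context). Let $R\ge 1$ be an integer, let $G$ be an observable of $R$ replicas, and let $0<\beta_1<\beta_2$. Then, in the thermodynamic limit $|\Lambda|\to\infty$, $$\int_{\beta_1^2}^{\beta_2^2}\Big\langle \sum_{\substack{k,l=1\\k\neq l}}^{R} G\, q_{l,k} - 2R\, G\sum_{l=1}^{R} q_{l,R+1} + R(R+1)\, G\, q_{R+1,R+2}\Big\rangle\, d\beta^2 \;\to\; 0$$ and $$\int_{\beta_1^2}^{\beta_2^2}\Big[\sum_{k=1}^{R}\langle G\, q_{k,R+1}\rangle - (R+1)\langle G\, q_{R+1,R+2}\rangle + \langle G\rangle\langle q_{1,2}\rangle\Big]\, d\beta^2 \;\to\; 0,$$ where all quenched expectations are taken at inverse temperature $\beta=\sqrt{\beta^2}$ and volume $\Lambda$.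
   Context: For each finite $d$-dimensional parallelepiped $\Lambda\subset\mathbb{Z}^d$ let $\Sigma_\Lambda=\{-1,1\}^\Lambda$, and for $X\subset\Lambda$ let $\sigma_X=\prod_{i\in X}\sigma_i$ (with $\sigma_\emptyset=0$). Let $\{J_X\}$ be independent centered Gaussian random variables with variances $\mathrm{Av}(J_X^2)=\Delta_X^2$, translation invariant ($\Delta^2_{X+a}=\Delta^2_X$), where $\mathrm{Av}$ denotes expectation over the $J$'s. The Hamiltonian is $H_\Lambda(\sigma)=-\sum_{X\subset\Lambda}J_X\sigma_X$. Its covariance is $\mathcal{C}_\Lambda(\sigma,\tau)=\mathrm{Av}(H_\Lambda(\sigma)H_\Lambda(\tau))=\sum_{X\subset\Lambda}\Delta_X^2\sigma_X\tau_X$, and the normalized covariance is $c_\Lambda(\sigma,\tau)=\mathcal{C}_\Lambda(\sigma,\tau)/|\Lambda|$. The Hamiltonian is thermodynamically stable if there is $\bar c<\infty$ with $\sup_{\Lambda}\frac{1}{|\Lambda|}\sum_{X\subset\Lambda}\Delta_X^2\le\bar c$. Let $\mathcal{Z}(\beta)=\sum_{\sigma\in\Sigma_\Lambda}e^{-\beta H_\Lambda(\sigma)}$. For $n\ge1$ the $n$-replica random Gibbs state is $\Omega_n(f)=\sum_{\sigma^{(1)},\dots,\sigma^{(n)}}f(\sigma^{(1)},\dots,\sigma^{(n)})\,e^{-\beta\sum_{i=1}^n H_\Lambda(\sigma^{(i)})}/\mathcal{Z}(\beta)^n$, and the quenched state is $\langle f\rangle=\mathrm{Av}(\Omega_n(f))$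 (with $n$ large enough for $f$). An observable of $R$ replicas is a smooth function $G$ of an $R\times R$ real matrix with $|G|\le 1$ (no permutation symmetry assumed), evaluated at the matrix $(c_\Lambda(\sigma^{(k)},\sigma^{(l)}))_{k,l\le R}$. The generalized overlap notation means: $\langle G\rangle=\mathrm{Av}\,\Omega_R(G(c_\Lambda))$, $\langle G\,q_{k,l}\rangle=\mathrm{Av}\,\Omega_n\big(G((c_\Lambda(\sigma^{(i)},\sigma^{(j)}))_{i,j\le R})\,c_\Lambda(\sigma^{(k)},\sigma^{(l)})\big)$ with $n=\max(R,k,l)$, and $\langle q_{1,2}\rangle=\mathrm{Av}\,\Omega_2(c_\Lambda(\sigma^{(1)},\sigma^{(2)}))$. The thermodynamic limit is the limit along boxes $\Lambda$ with $|\Lambda|\to\infty$. *)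

(* Defs.v *)
From HB Require Import structures.
From mathcomp Require Import all_boot all_order all_algebra finmap.
From mathcomp Require Import all_classical all_reals all_analysis.
Set Implicit Arguments. Unset Strict Implicit. Unset Printing Implicit Defensive.
Import Order.TTheory GRing.Theory Num.Theory.
Import numFieldNormedType.Exports.
Local Open Scope classical_set_scope.
Local Open Scope ring_scope.

(** Sites of the box Λ = Π_i [a_i, a_i + L_i) ⊂ Z^d, coded by offsets. *)
Definition site (d : nat) (L : 'I_d -> nat) := {dffun forall i : 'I_d, 'I_(L i)}.

Definition emb (d : nat) (a : 'I_d -> int) (L : 'I_d -> nat) (x : site L)
  : 'rV[int]_d := \row_i (a i + (nat_of_ord (x i))%:Z).

Definition embX (d : nat) (a : 'I_d -> int) (L : 'I_d -> nat) (X : {set site L})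
  : {fset 'rV[int]_d} := [fset emb a x | x in enum X]%fset.

Definition translate (d : nat) (X : {fset 'rV[int]_d}) (b : 'rV[int]_d)
  : {fset 'rV[int]_d} := [fset (x + b)%R | x in X]%fset.

(** Spin configurations σ ∈ {-1,1}^Λ, coded by booleans (true = +1). *)
Definition config (d : nat) (L : 'I_d -> nat) := {ffun site L -> bool}.

Definition spin (R : realType) (b : bool) : R := if b then 1 else -1.

Definition sigmaX (R : realType) (d : nat) (L : 'I_d -> nat)
  (X : {set site L}) (s : config L) : R :=
  if X == finset.set0 then 0 else \prod_(i in X) spin R (s i).
Arguments sigmaX {R d L} X s.

(** Hamiltonian H_Λ(σ) = - Σ_{X⊂Λ} J_X σ_X with J_X = Delta(X) g_X, where
    the g_X are i.i.d. standard Gaussians; so Var J_X = Delta(X)^2. *)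
Definition Ham (R : realType) (d : nat) (a : 'I_d -> int) (L : 'I_d -> nat)
  (Delta : {fset 'rV[int]_d} -> R) (g : {set site L} -> R) (s : config L) : R :=
  - \sum_(X : {set site L}) (Delta (embX a X) * g X) * sigmaX X s.

Definition cov (R : realType) (d : nat) (a : 'I_d -> int) (L : 'I_d -> nat)
  (Delta : {fset 'rV[int]_d} -> R) (s t : config L) : R :=
  (#|site L|%:R)^-1 *
  \sum_(X : {set site L}) Delta (embX a X) ^+ 2 * sigmaX X s * sigmaX X t.

Definition Zpart (R : realType) (d : nat) (a : 'I_d -> int) (L : 'I_d -> nat)
  (Delta : {fset 'rV[int]_d} -> R) (beta : R) (g : {set site L} -> R) : R :=
  \sum_(s : config L) expR (- beta * Ham a Delta g s).

Definition Omega (R : realType) (d : nat) (a : 'I_d -> int) (L : 'I_d -> nat)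
  (Delta : {fset 'rV[int]_d} -> R) (n : nat) (beta : R) (g : {set site L} -> R)
  (f : {ffun 'I_n -> config L} -> R) : R :=
  (\sum_(ss : {ffun 'I_n -> config L})
      f ss * expR (- beta * \sum_(i < n) Ham a Delta g (ss i)))
  / Zpart a Delta beta g ^+ n.

Fixpoint avs (R : realType) (I : eqType) (s : seq I) (F : (I -> R) -> R)
  (J : I -> R) : R :=
  match s with
  | [::] => F J
  | i :: s' => \int[@lebesgue_measure R]_(x in setT)
      (normal_pdf 0 1 x * avs s' F (fun j => if j == i then x else J j))
  end.

(** Av: expectation over an i.i.d. standard Gaussian family (g_i)_{i : I}. *)
Definition Av (R : realType) (I : finType) (F : (I -> R) -> R) : R :=
  avs (enum I) F (fun _ => 0).

(** Replica number k (0-based) of a replica tuple (default if out of range). *)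
Definition rep (d : nat) (L : 'I_d -> nat) (n : nat)
  (ss : {ffun 'I_n -> config L}) (k : nat) : config L :=
  odflt [ffun => true] (omap ss (insub k)).

Definition cmat (R : realType) (d : nat) (a : 'I_d -> int) (L : 'I_d -> nat)
  (Delta : {fset 'rV[int]_d} -> R) (r n : nat) (ss : {ffun 'I_n -> config L})
  : 'M[R]_r := \matrix_(i < r, j < r) cov a Delta (rep ss i) (rep ss j).

Definition qavG (R : realType) (d : nat) (a : 'I_d -> int) (L : 'I_d -> nat)
  (Delta : {fset 'rV[int]_d} -> R) (r : nat) (G : 'M[R]_r -> R) (beta : R) : R :=
  Av (fun g : {set site L} -> R =>
        Omega (n := r) a Delta beta g (fun ss => G (cmat a Delta r ss))).

(** ⟨G q_{k,l}⟩ with 0-based replica indices k, l (paper's k+1, l+1);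
    computed with n = max(r, k+1, l+1) replicas. *)
Definition qavGq (R : realType) (d : nat) (a : 'I_d -> int) (L : 'I_d -> nat)
  (Delta : {fset 'rV[int]_d} -> R) (r : nat) (G : 'M[R]_r -> R) (k l : nat)
  (beta : R) : R :=
  Av (fun g : {set site L} -> R =>
        Omega (n := maxn r (maxn k.+1 l.+1)) a Delta beta g
          (fun ss => G (cmat a Delta r ss) * cov a Delta (rep ss k) (rep ss l))).

Definition qavq12 (R : realType) (d : nat) (a : 'I_d -> int) (L : 'I_d -> nat)
  (Delta : {fset 'rV[int]_d} -> R) (beta : R) : R :=
  Av (fun g : {set site L} -> R =>
        Omega (n := 2) a Delta beta g (fun ss => cov a Delta (rep ss 0) (rep ss 1))).

Fixpoint smoothn (R : realType) (V : normedModType R) (k : nat) (f : V -> R) : Prop :=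
  match k with
  | 0 => continuous f
  | k'.+1 => (forall x v : V, derivable f x v) /\
             (forall v : V, smoothn k' (fun x => 'D_v f x))
  end.

Definition smooth (R : realType) (V : normedModType R) (f : V -> R) : Prop :=
  forall k, smoothn k f.

(** The two integrands of the theorem (replica indices 0-based:
    paper's 1..R  ↦ 0..r-1, R+1 ↦ r, R+2 ↦ r+1). *)
Definition integrand1 (R : realType) (d : nat) (a : 'I_d -> int) (L : 'I_d -> nat)
  (Delta : {fset 'rV[int]_d} -> R) (r : nat) (G : 'M[R]_r -> R) (beta : R) : R :=
  \sum_(k < r) \sum_(l < r | k != l) qavGq a L Delta G l k beta
  - (2 * r)%:R * \sum_(l < r) qavGq a L Delta G l r beta
  + (r * r.+1)%:R * qavGq a L Delta G r r.+1 beta.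

Definition integrand2 (R : realType) (d : nat) (a : 'I_d -> int) (L : 'I_d -> nat)
  (Delta : {fset 'rV[int]_d} -> R) (r : nat) (G : 'M[R]_r -> R) (beta : R) : R :=
  \sum_(k < r) qavGq a L Delta G k r beta
  - r.+1%:R * qavGq a L Delta G r r.+1 beta
  + qavG a L Delta G beta * qavq12 a L Delta beta.

(* Main.v *)
(** With N sites, write h for minus the Hamiltonian, <.> for the quenched mean
    and C for the normalized covariance. Gaussian integration by parts gives,
    for a function F of n replicas and k <= n,
      <F h(s_k)> = b N (sum_(l <= n) <F C(s_k, s_l)> - n <F C(s_k, s_(n+1))>).

    First identity: inserting this in d<G>/db = sum_k <G h(s_k)> - R <G h(s_(R+1))>
    yields d<G>/d(b^2) = (N / 2) * integrand, so the integral is at most 4 / N.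

    Second identity: the same formula with n = k = R + 1 gives
      b * integrand = Av (Omega(G) (p' - Av p')),  p = (log Z) / N.
    Since p is a Lipschitz function of the Gaussians its variance is O(1 / N), and
    as p and Av p are convex in b, difference quotients of step de bound
    Av |p' - Av p'| by O(Av |p - Av p| / de) plus an increment of (Av p)' over
    [b - de, b + de], whose b-integral is O(de).

    [Av] is an iterated integral; instead of Fubini or differentiation under the
    integral sign, every limit is replaced by a quantitative Taylor or Lipschitz
    bound with an integrable constant, which survives integration by linearity
    and monotonicity alone. *)
Require Import Defs.
From HB Require Import structures.
From mathcomp Require Import all_boot all_order all_algebra finmap.
From mathcomp Require Import all_classical all_reals all_analysis.
From mathcomp Require Import measurable_realfun ring lra.
Import Order.TTheory GRing.Theory Num.Theory.
Import numFieldNormedType.Exports.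
Local Open Scope classical_set_scope.
Local Open Scope ring_scope.
Set Implicit Arguments. Unset Strict Implicit. Unset Printing Implicit Defensive.

(** * Gaussian means in one variable *)

(** Both identities rest on the self-covariance [C(s, s)] being the same for all [s], since a
    product of signs squares to one: integration by parts produces it twice, with opposite signs.
    Nothing else about spins matters for the cancellations, so the argument runs for a field
    [\sum_i c i * g i * sg i t] over arbitrary finite sets and is specialized only at the end. In
    the second identity the fluctuation term costs O(1 / (N de^3)) + O(de) and the increment term
    O(de), so [de] is fixed from the tolerance before N grows. The cube comes from bounding a mean
    absolute value by [2 y <= y^2 / la + la] with [la = de^2], followed by a division by [de].
    Observables are functions of an infinite sequence of replicas, so that one observable can be
    averaged over n, n + 1 or n + 2 replicas without changing its type. *)

Definition gauss_mean (R : realType) (u : R -> R) : R :=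
  \int[@lebesgue_measure R]_(x in setT) (normal_pdf 0 1 x * u x).

(** Continuity is there for measurability, the exponential bound for integrability against the
    Gaussian density. *)
Definition exp_growth (R : realType) (u : R -> R) : Prop :=
  continuous u /\ exists A B : R, forall x, `|u x| <= A * expR (B * `|x|).

Lemma normal_pdf_unfold (R : realType) (m s x : R) : s != 0 ->
  normal_pdf m s x = normal_peak s * normal_fun m s x.
Proof. by move=> s0; rewrite normal_pdfE. Qed.

(** A wider Gaussian absorbs the exponential: [(B - y / 2)^2 >= 0] gives [B y <= B^2 + y^2 / 4], and
    1/4 is below the gap 1/2 - 1/8 between the two exponents. *)
Lemma gauss_expR_le (R : realType) (B x : R) :
  normal_pdf 0 1 x * expR (B * `|x|) <=
  (normal_peak 1 / normal_peak 2 * expR (B ^+ 2)) * normal_pdf 0 2 x.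
Proof.
have p2 : normal_peak (2 : R) != 0 by rewrite gt_eqF// normal_peak_gt0.
have p1 : 0 <= normal_peak (1 : R) by rewrite normal_peak_ge0.
rewrite !normal_pdf_unfold// /normal_fun subr0 -[leLHS]mulrA -expRD.
have -> : normal_peak 1 / normal_peak 2 * expR (B ^+ 2)
   * (normal_peak 2 * expR (- x ^+ 2 / (2 ^+ 2 *+ 2)))
   = normal_peak 1 * expR (B ^+ 2 + (- x ^+ 2 / (2 ^+ 2 *+ 2))) :> R.
  by rewrite expRD; field.
apply: ler_wpM2l => //; rewrite ler_expR.
have -> : x ^+ 2 = `|x| ^+ 2 by rewrite real_normK// num_real.
move: `|x| => y.
have h1 := sqr_ge0 (B - y / 2); have h2 := sqr_ge0 y.
have -> : (1 : R) ^+ 2 *+ 2 = 2 by ring.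
have -> : (2 : R) ^+ 2 *+ 2 = 8 by ring.
nra.
Qed.

Section gauss_mean_theory.
Context {R : realType}.
Implicit Types u v : R -> R.
Notation mu := (@lebesgue_measure R).

Lemma exp_growth_integrable u : exp_growth u ->
  mu.-integrable setT (EFin \o (fun x => normal_pdf 0 1 x * u x)).
Proof.
move=> [cu [A [B uAB]]].
have i2 := integrable_normal_pdf (0 : R) 2.
have i3 := integrableZl measurableT
  (`|A| * (normal_peak 1 / normal_peak 2 * expR (B ^+ 2))) i2.
apply: le_integrable i3 => //=.
  apply/measurable_EFinP; apply: measurable_funM => //.
    exact: measurable_normal_pdf.
  exact: continuous_measurable_fun.
move=> x _; rewrite lee_fin normrM (ger0_norm (normal_pdf_ge0 _ _ _)).
rewrite normrM (ger0_norm (normal_pdf_ge0 _ _ _)).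
apply: (@le_trans _ _ (`|A| * (normal_pdf 0 1 x * expR (B * `|x|)))).
  rewrite mulrCA; apply: ler_wpM2l; first exact: normal_pdf_ge0.
  apply: (le_trans (uAB x)); apply: ler_wpM2r; first exact: expR_ge0.
  exact: ler_norm.
rewrite normrM normr_id -mulrA; apply: ler_wpM2l => //.
apply: (le_trans (gauss_expR_le _ _)).
by apply: ler_wpM2r; [exact: normal_pdf_ge0|exact: ler_norm].
Qed.

Lemma exp_growthD u v : exp_growth u -> exp_growth v ->
  exp_growth (fun x => u x + v x).
Proof.
move=> [cu [A [B uAB]]] [cv [A' [B' vAB]]]; split.
  by move=> x; apply: cvgD; [exact: cu|exact: cv].
have weaken (a b c x : R) : b <= c ->
    a * expR (b * `|x|) <= `|a| * expR (c * `|x|).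
  move=> bc; apply: (@le_trans _ _ (`|a| * expR (b * `|x|))).
    by rewrite ler_wpM2r ?expR_ge0 ?ler_norm.
  by rewrite ler_wpM2l// ler_expR ler_wpM2r.
exists (`|A| + `|A'|), (`|B| + `|B'|) => x.
apply: (le_trans (ler_normD _ _)); rewrite mulrDl; apply: lerD.
- apply: (le_trans (uAB x)); apply: weaken.
  by rewrite (le_trans (ler_norm B))// lerDl.
- apply: (le_trans (vAB x)); apply: weaken.
  by rewrite (le_trans (ler_norm B'))// lerDr.
Qed.

Lemma exp_growthZ c u : exp_growth u -> exp_growth (fun x => c * u x).
Proof.
move=> [cu [A [B uAB]]]; split.
  by move=> x; apply: cvgM; [exact: cvg_cst|exact: cu].
by exists (`|c| * A), B => x; rewrite normrM -mulrA ler_wpM2l.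
Qed.

Lemma gauss_mean_eq u v : u =1 v -> gauss_mean u = gauss_mean v.
Proof. by move=> /funext ->. Qed.

Lemma gauss_meanD u v : exp_growth u -> exp_growth v ->
  gauss_mean (fun x => u x + v x) = gauss_mean u + gauss_mean v.
Proof.
move=> hu hv; rewrite /gauss_mean -RintegralD//; try exact: exp_growth_integrable.
by apply: eq_Rintegral => x _; rewrite mulrDr.
Qed.

Lemma gauss_meanZ c u : exp_growth u ->
  gauss_mean (fun x => c * u x) = c * gauss_mean u.
Proof.
move=> hu; rewrite /gauss_mean -RintegralZl//; try exact: exp_growth_integrable.
by apply: eq_Rintegral => x _; rewrite mulrCA.
Qed.

Lemma gauss_mean_le u v : exp_growth u -> exp_growth v ->
  (forall x, u x <= v x) -> gauss_mean u <= gauss_mean v.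
Proof.
move=> hu hv uv; rewrite /gauss_mean; apply: le_Rintegral => //;
  try exact: exp_growth_integrable.
by move=> x _; apply: ler_wpM2l (uv x); exact: normal_pdf_ge0.
Qed.

Lemma gauss_mean_cst c : gauss_mean (fun=> c) = c :> R.
Proof.
rewrite /gauss_mean; under eq_Rintegral do rewrite mulrC.
rewrite RintegralZl//; last exact: integrable_normal_pdf.
by rewrite /Rintegral integral_normal_pdf/= mulr1.
Qed.

Lemma exp_growth_expR (B c : R) : exp_growth (fun x => c * expR (B * `|x|)).
Proof.
split; last first.
  exists `|c|, B => x; rewrite normrM ler_wpM2l//.
  by rewrite ger0_norm// expR_ge0.
move=> x; apply: cvgM; first exact: cvg_cst.
apply: (cvg_comp _ expR); last exact: continuous_expR.
apply: cvgM; first exact: cvg_cst.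
exact: (@norm_continuous _ R).
Qed.

Lemma exp_growth_cst (c : R) : exp_growth (fun=> c).
Proof.
have := exp_growth_expR 0 c.
by under eq_fun do rewrite mul0r expR0 mulr1.
Qed.

Lemma ler_norm_gauss_mean u v : exp_growth u -> exp_growth v ->
  (forall x, `|u x| <= v x) -> `|gauss_mean u| <= gauss_mean v.
Proof.
move=> hu hv uv; rewrite ler_norml; apply/andP; split.
  rewrite -mulN1r -gauss_meanZ//; apply: gauss_mean_le => //.
    exact: exp_growthZ.
  by move=> x; rewrite mulN1r; have := uv x; rewrite ler_norml => /andP[].
by apply: gauss_mean_le => // x; rewrite (le_trans (ler_norm _)).
Qed.

(** The substitution moves the shift from [u] to the density, which is explicit and can be expanded
    in [h]. It is made for nonnegative integrands, hence the sign condition. *)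
Lemma gauss_mean_shift u h : exp_growth u -> (forall x, 0 <= u x) ->
  gauss_mean (fun x => u (x + h)) =
  \int[mu]_x (normal_pdf 0 1 (x - h) * u x).
Proof.
move=> [cu _] u0; rewrite /gauss_mean /Rintegral; congr fine; symmetry.
have dF x : is_derive x (1 : R) (fun y : R => y + h) 1.
  by apply: is_derive_eq; rewrite addr0.
have F1 : derive1 (fun y : R => y + h) = cst 1.
  by apply/funext => x; rewrite derive1E derive_val.
rewrite (@increasing_ge0_integration_by_substitutionT _ (fun y => y + h)).
- by apply: eq_integral => x _ /=; rewrite F1 !fctE mulr1 addrK.
- by move=> x y; rewrite ltrD2r.
- by rewrite F1 => x; exact: cvg_cst.
- by rewrite F1; exact: is_cvg_cst.
- by rewrite F1; exact: is_cvg_cst.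
- by move=> x; exact: ex_derive.
- exact: cvg_addrr_Ny.
- exact: cvg_addrr.
- move=> x; apply: cvgM; last exact: cu.
  apply: (cvg_comp (fun y => y - h)); last exact: continuous_normal_pdf.
  by apply: cvgB; [exact: cvg_id|exact: cvg_cst].
- by move=> x; rewrite mulr_ge0// normal_pdf_ge0.
Qed.

(** Using [1 + z <= expR z] at [z = y] and [z = - y] gives
    [0 <= expR y - 1 - y <= y * (expR y - 1)]. *)
Lemma expR_taylor1 (y : R) : `|expR y - 1 - y| <= y ^+ 2 * expR `|y|.
Proof.
have h1 := expR_ge1Dx y.
have h2 := expR_ge1Dx (- y).
have e0 := expR_gt0 y.
have eN : expR (- y) * expR y = 1 by rewrite -expRD addNr expR0.
have h3 : (1 - y) * expR y <= expR (- y) * expR y by rewrite ler_pM2r.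
rewrite eN in h3.
rewrite ger0_norm; last by lra.
have [y0|y0] := leP 0 y.
  rewrite ger0_norm//; nra.
have e1 : 1 <= expR `|y| by rewrite -expR0 ler_expR.
apply: (@le_trans _ _ (y ^+ 2)); last by rewrite ler_peMr// sqr_ge0.
have e2 : expR y <= 1 by rewrite -expR0 ler_expR ltW.
nra.
Qed.

(** The shifted density is the density times [expR (h x - h^2 / 2)]. The remainder keeps the density
    as a factor, so it stays integrable after multiplication by a bounded function. *)
Lemma pdf_shift_taylor (x h : R) : `|h| <= 1 ->
  `|normal_pdf 0 1 (x - h) - normal_pdf 0 1 x - h * (normal_pdf 0 1 x * x)|
  <= h ^+ 2 * (normal_pdf 0 1 x * (4 * expR 2 * expR (4 * `|x|))).
Proof.
move=> h1; set y := h * x - h ^+ 2 / 2.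
have -> : normal_pdf 0 1 (x - h) = normal_pdf 0 1 x * expR y.
  rewrite !normal_pdf_unfold// /normal_fun !subr0 -mulrA -expRD; congr (_ * expR _).
  by rewrite /y; field.
have p0 := normal_pdf_ge0 0 1 x.
set p := normal_pdf 0 1 x in p0 *.
have -> : p * expR y - p - h * (p * x) = p * ((expR y - 1 - y) - h ^+ 2 / 2).
  by rewrite /y; field.
rewrite normrM ger0_norm// mulrCA; apply: ler_wpM2l => //.
have ax := normr_ge0 x.
have ah := normr_ge0 h.
have hy : `|y| <= `|h| * (`|x| + 1).
  apply: (le_trans (ler_normB _ _)); rewrite mulrDr mulr1 normrM lerD2l.
  rewrite normrM normrX (ger0_norm (_ : 0 <= 2^-1)); last by rewrite invr_ge0.
  nra.
have hy2 : y ^+ 2 <= h ^+ 2 * expR (2 * `|x|).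
  rewrite -(real_normK (num_real y)) -(real_normK (num_real h)).
  apply: (@le_trans _ _ ((`|h| * (`|x| + 1)) ^+ 2)).
    by rewrite lerXn2r// ?nnegrE ?mulr_ge0// addr_ge0.
  rewrite exprMn; apply: ler_wpM2l; first exact: sqr_ge0.
  rewrite mulr2n mulrDl !mul1r expRD expr2.
  have := expR_ge1Dx `|x| => ?.
  by apply: ler_pM => //; lra.
have ey : expR `|y| <= expR 2 * expR (2 * `|x|).
  by rewrite -expRD ler_expR; nra.
have e1 : 1 <= expR (2 : R) by rewrite -expR0 ler_expR.
have e2 : 1 <= expR (4 * `|x|) by rewrite -expR0 ler_expR mulr_ge0.
have := expR_taylor1 y => ty.
apply: (le_trans (ler_normB _ _)).
rewrite (ger0_norm (_ : 0 <= h ^+ 2 / 2)); last by rewrite mulr_ge0// sqr_ge0.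
have h20 := sqr_ge0 h.
have b1 : y ^+ 2 * expR `|y| <= h ^+ 2 * (expR 2 * expR (4 * `|x|)).
  apply: (@le_trans _ _ ((h ^+ 2 * expR (2 * `|x|)) * (expR 2 * expR (2 * `|x|)))).
    by rewrite ler_pM ?sqr_ge0 ?expR_ge0.
  have -> : (4 * `|x| = 2 * `|x| + 2 * `|x|)%R by ring.
  by rewrite (expRD (2 * `|x|)) le_eqVlt; apply/orP; left; apply/eqP; ring.
have b2 : 1 <= expR 2 * expR (4 * `|x|) by rewrite -[leLHS]mulr1 ler_pM.
apply: (@le_trans _ _ (h ^+ 2 * (expR 2 * expR (4 * `|x|)) + h ^+ 2 / 2)).
  by apply: lerD => //; apply: (le_trans ty).
by nra.
Qed.

(** Plays the part of the limit [h -> 0]: a linear term dominated by a quadratic one vanishes. *)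
Lemma eq0_of_quadratic (c K : R) :
  (forall h : R, 0 < h -> h <= 1 -> `|h * c| <= K * h ^+ 2) -> c = 0.
Proof.
move=> H; apply/eqP; rewrite -normr_le0; apply/ler_addgt0Pl => e e0.
rewrite addr0.
have K1 : 0 < `|K| + 1 by rewrite ltr_wpDl.
pose h := Num.min 1 (e / (`|K| + 1)).
have h0 : 0 < h by rewrite lt_min ltr01 divr_gt0.
have hK : h * (`|K| + 1) <= e by rewrite -ler_pdivlMr// ge_min lexx orbT.
have := H h h0; rewrite ge_min lexx => /(_ isT).
rewrite normrM gtr0_norm// expr2 mulrCA ler_pM2l// => /le_trans; apply.
have := ler_norm K; nra.
Qed.

(* Stein's identity: compare the two first-order expansions in [h] of
   [E u(g + h)], obtained from [u] and from the density. *)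
Lemma gauss_ibp_ge0 u v (A : R) :
  exp_growth u -> exp_growth v -> exp_growth (fun x => x * u x) ->
  (forall h, exp_growth (fun x => u (x + h))) ->
  (forall x, 0 <= u x) -> (exists M, forall x, u x <= M) ->
  (forall x h, `|u (x + h) - u x - h * v x| <= A * h ^+ 2) ->
  gauss_mean (fun x => x * u x) = gauss_mean v.
Proof.
move=> hu hv hxu huh u0 [M uM] taylor.
have hK := exp_growth_expR 4 (4 * expR 2).
have M0 : 0 <= M by rewrite (le_trans (u0 0)).
pose K := gauss_mean (fun x : R => 4 * expR 2 * expR (4 * `|x|)).
apply/eqP; rewrite -subr_eq0; apply/eqP.
apply: (@eq0_of_quadratic _ (A + M * K)) => h h0 h1.
have e1 : `|gauss_mean (fun x => u (x + h)) - gauss_mean u - h * gauss_mean v|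
    <= A * h ^+ 2.
  have -> : gauss_mean (fun x => u (x + h)) - gauss_mean u - h * gauss_mean v =
      gauss_mean (fun x => u (x + h) + (-1 * u x + (- h) * v x)).
    rewrite (gauss_meanD (huh h) (exp_growthD (exp_growthZ _ hu) (exp_growthZ _ hv))).
    rewrite (gauss_meanD (exp_growthZ _ hu) (exp_growthZ _ hv)) !gauss_meanZ//.
    ring.
  rewrite -[leRHS](gauss_mean_cst (A * h ^+ 2)); apply: ler_norm_gauss_mean.
  - apply: exp_growthD => //; apply: exp_growthD; exact: exp_growthZ.
  - exact: exp_growth_cst.
  - by move=> x; have := taylor x h; rewrite mulN1r mulNr addrA.
have e2 : `|gauss_mean (fun x => u (x + h)) - gauss_mean u
     - h * gauss_mean (fun x => x * u x)| <= M * K * h ^+ 2.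
  rewrite gauss_mean_shift//.
  have iu := exp_growth_integrable hu.
  have ixu := exp_growth_integrable hxu.
  have ish : mu.-integrable setT (EFin \o (fun x => normal_pdf 0 1 (x - h) * u x)).
    have i1 := integrableZl measurableT M (integrable_normal_pdf h 1).
    apply: le_integrable i1 => //=.
      apply/measurable_EFinP; apply: measurable_funM => //; last first.
        by apply: continuous_measurable_fun; case: hu.
      apply: (measurableT_comp (measurable_normal_pdf 0 1)).
      exact: measurable_funB.
    move=> x _; rewrite lee_fin.
    have -> : normal_pdf 0 1 (x - h) = normal_pdf h 1 x.
      by rewrite !normal_pdf_unfold// /normal_fun subr0.
    rewrite !normrM mulrC; apply: ler_wpM2r => //.
    by rewrite !ger0_norm.
  have ik := exp_growth_integrable hK.
  have ihxu := integrableZl measurableT h ixu.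
  have iB := integrableB measurableT ish iu.
  have iBB := integrableB measurableT iB ihxu.
  rewrite /gauss_mean -RintegralB// -RintegralZl// -RintegralB//.
  apply: (le_trans (le_normr_Rintegral _ iBB)) => //.
  rewrite [leRHS]mulrAC /K /gauss_mean -[leRHS]RintegralZl//.
  apply: le_Rintegral => //.
  - exact: integrable_norm iBB.
  - exact: (integrableZl measurableT (M * h ^+ 2) ik).
  move=> x _ /=.
  have -> : normal_pdf 0 1 (x - h) * u x - normal_pdf 0 1 x * u x -
     h * (normal_pdf 0 1 x * (x * u x)) =
     (normal_pdf 0 1 (x - h) - normal_pdf 0 1 x - h * (normal_pdf 0 1 x * x)) * u x.
    by ring.
  rewrite normrM (ger0_norm (u0 x)) (mulrC M) mulrAC.
  apply: ler_pM => //; apply: pdf_shift_taylor.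
  by rewrite gtr0_norm.
rewrite mulrBr; move: e1 e2; rewrite !ler_norml.
move=> /andP[? ?] /andP[? ?]; apply/andP; split; lra.
Qed.

(** Adding [M] reduces to the nonnegative case. The extra term is [M] times the mean of [x], which
    is zero by the same nonnegative case applied to the constant 1. *)
Lemma gauss_ibp u v (A M : R) :
  exp_growth u -> exp_growth v -> exp_growth (fun x => x * u x) ->
  (forall h, exp_growth (fun x => u (x + h))) ->
  (forall x, `|u x| <= M) ->
  (forall x h, `|u (x + h) - u x - h * v x| <= A * h ^+ 2) ->
  gauss_mean (fun x => x * u x) = gauss_mean v.
Proof.
move=> hu hv hxu huh uM taylor.
have M0 : 0 <= M by rewrite (le_trans _ (uM 0)).
have hc := @exp_growth_cst.
have hx : exp_growth (fun x : R => x).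
  split; first by move=> x; exact: cvg_id.
  exists 1, 1 => x; rewrite !mul1r (le_trans _ (expR_ge1Dx _))//.
  by rewrite lerDr.
have x0 : gauss_mean (fun x : R => x * 1) = gauss_mean (fun=> 0).
  apply: (@gauss_ibp_ge0 (fun=> 1) (fun=> 0) 0) => //.
  - by under eq_fun do rewrite mulr1.
  - by exists 1.
  - by move=> x h; rewrite mulr0 subrr subr0 normr0 mul0r.
have : gauss_mean (fun x => x * (u x + M)) = gauss_mean v.
  apply: (@gauss_ibp_ge0 (fun x => u x + M) v A) => //.
  - exact: exp_growthD.
  - under eq_fun do rewrite mulrDr; apply: exp_growthD => //.
    by under eq_fun do rewrite mulrC; exact: exp_growthZ.
  - by move=> h; exact: exp_growthD.
  - by move=> x; have := uM x; rewrite ler_norml => /andP[]; lra.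
  - by exists (M + M) => x; rewrite lerD2r (le_trans (ler_norm _)).
  - move=> x h; apply: le_trans (taylor x h).
    by rewrite le_eqVlt; apply/orP; left; apply/eqP; congr `|_|; ring.
move=> <-; under [RHS]gauss_mean_eq do rewrite mulrDr (mulrC _ M).
rewrite gauss_meanD//; last exact: exp_growthZ.
rewrite gauss_meanZ//.
move: x0; rewrite gauss_mean_cst; under gauss_mean_eq do rewrite mulr1.
by move=> ->; rewrite mulr0 addr0.
Qed.

End gauss_mean_theory.

(** * Functions of finitely many variables with exponential growth *)

(** Convertible with the substitution inside [avs], so that [avs_cons] holds by computation; it also
    replaces a single replica in a sequence. *)
Definition upd (T : eqType) (V : Type) (J : T -> V) (i : T) (x : V) : T -> V :=
  fun j => if j == i then x else J j.

Lemma upd_same (T : eqType) (V : Type) (J : T -> V) i x : upd J i x i = x.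
Proof. by rewrite /upd eqxx. Qed.

Lemma upd_upd (T : eqType) (V : Type) (J : T -> V) i x y :
  upd (upd J i x) i y = upd J i y.
Proof. by apply/funext => j; rewrite /upd; case: eqVneq. Qed.

Lemma updC (T : eqType) (V : Type) (J : T -> V) i j x y : i != j ->
  upd (upd J i x) j y = upd (upd J j y) i x.
Proof.
move=> ij; apply/funext => k; rewrite /upd; have [->|//] := eqVneq k j.
by rewrite eq_sym (negbTE ij).
Qed.

Section tame.
Context {R : realType} {I : finType}.
Implicit Types (J K : I -> R) (F G : (I -> R) -> R).

Definition l1 J : R := \sum_i `|J i|.

(** This class is closed under products and under integrating out a coordinate
    against a Gaussian, and makes every iterated integral below convergent. *)
Definition tame F : Prop := exists A B : R,
  [/\ 0 <= A, 0 <= B, forall J, `|F J| <= A * expR (B * l1 J) &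
      forall J K, `|F J - F K| <=
        A * expR (B * (l1 J + l1 K)) * l1 (fun i => J i - K i)].

Lemma l1_ge0 J : 0 <= l1 J.
Proof. by apply: sumr_ge0. Qed.

Lemma ler_l1 J i : `|J i| <= l1 J.
Proof. by rewrite /l1 (bigD1 i)//= lerDl sumr_ge0. Qed.

Lemma l1_upd J i x : l1 (upd J i x) <= l1 J + `|x|.
Proof.
rewrite /l1 (bigD1 i)//= [in leRHS](bigD1 i)//= upd_same addrC lerD2r.
rewrite (eq_bigr (fun j => `|J j|)) ?lerDr// => j ji.
by rewrite /upd (negbTE ji).
Qed.

Lemma l1_updB J i x y : l1 (fun j => upd J i x j - upd J i y j) = `|x - y|.
Proof.
rewrite /l1 (bigD1 i)//= !upd_same big1 ?addr0// => j ji.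
by rewrite /upd (negbTE ji) subrr normr0.
Qed.

Lemma l1_updBl J K i x :
  l1 (fun j => upd J i x j - upd K i x j) <= l1 (fun j => J j - K j).
Proof.
apply: ler_sum => j _; rewrite /upd; case: eqVneq => // _.
by rewrite subrr normr0.
Qed.

Lemma tame_lip F (M L : R) : (forall J, `|F J| <= M) ->
  (forall J K, `|F J - F K| <= L * l1 (fun i => J i - K i)) -> tame F.
Proof.
move=> FM FL; exists (`|M| + `|L|), 0; split => //.
- move=> J; rewrite mul0r expR0 mulr1 (le_trans (FM J))//.
  by rewrite (le_trans (ler_norm M))// lerDl.
- move=> J K; rewrite mul0r expR0 mulr1 (le_trans (FL J K))// ler_wpM2r ?l1_ge0//.
  by rewrite (le_trans (ler_norm L))// lerDr.
Qed.

Lemma tame_cst c : tame (fun=> c).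
Proof.
apply: (@tame_lip _ `|c| 0) => // J K.
by rewrite subrr normr0 mul0r.
Qed.

Lemma tame_coord i : tame (fun J => J i).
Proof.
exists 1, 1; split => //.
- move=> J; rewrite !mul1r (le_trans (ler_l1 J i))//.
  by rewrite (le_trans _ (expR_ge1Dx _))// lerDr.
- move=> J K; rewrite !mul1r.
  rewrite -[leLHS]mul1r; apply: ler_pM => //.
    by rewrite -expR0 ler_expR addr_ge0 ?l1_ge0.
  exact: (ler_l1 (fun i => J i - K i)).
Qed.

Lemma tame_norm F : tame F -> tame (fun J => `|F J|).
Proof.
move=> [A [B [A0 B0 FA FL]]]; exists A, B; split => //.
  by move=> J; rewrite normr_id.
by move=> J K; rewrite (le_trans (ler_dist_dist _ _)).
Qed.

Lemma ler_mul_expR (a a' b b' x : R) : 0 <= a -> a <= a' -> b <= b' -> 0 <= x ->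
  a * expR (b * x) <= a' * expR (b' * x).
Proof.
move=> a0 aa bb x0; apply: ler_pM; rewrite ?expR_ge0//.
by rewrite ler_expR ler_wpM2r.
Qed.

Lemma tameD F G : tame F -> tame G -> tame (fun J => F J + G J).
Proof.
move=> [A [B [A0 B0 FA FL]]] [A' [B' [A0' B0' GA GL]]].
exists (A + A'), (B + B'); split; rewrite ?addr_ge0//.
- move=> J; rewrite (le_trans (ler_normD _ _))// mulrDl lerD//.
  + by rewrite (le_trans (FA J))// ler_mul_expR ?l1_ge0// lerDl.
  + by rewrite (le_trans (GA J))// ler_mul_expR ?l1_ge0// lerDr.
- move=> J K; rewrite opprD addrACA (le_trans (ler_normD _ _))// !mulrDl lerD//.
  + rewrite (le_trans (FL J K))// ler_wpM2r ?l1_ge0//.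
    by rewrite -mulrDl ler_mul_expR ?addr_ge0 ?l1_ge0// lerDl.
  + rewrite (le_trans (GL J K))// ler_wpM2r ?l1_ge0//.
    by rewrite -mulrDl ler_mul_expR ?addr_ge0 ?l1_ge0// lerDr.
Qed.

Lemma tameM F G : tame F -> tame G -> tame (fun J => F J * G J).
Proof.
move=> [A [B [A0 B0 FA FL]]] [A' [B' [A0' B0' GA GL]]].
exists (A * A' *+ 2), (B + B'); split; rewrite ?addr_ge0 ?mulrn_wge0 ?mulr_ge0//.
- move=> J; rewrite normrM (le_trans (ler_pM _ _ (FA J) (GA J)))//.
  rewrite (mulrDl B) expRD mulrACA ler_wpM2r ?mulr_ge0 ?expR_ge0//.
  by rewrite mulr2n lerDl mulr_ge0.
- move=> J K.
  have -> : F J * G J - F K * G K = F J * (G J - G K) + (F J - F K) * G K by ring.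
  rewrite (le_trans (ler_normD _ _))// mulr2n (mulrDl B) expRD.
  set eB := expR (B * _); set eB' := expR (B' * _); set D := l1 (fun i => J i - K i).
  have D0 : 0 <= D by exact: l1_ge0.
  have -> : (A * A' + A * A') * (eB * eB') * D =
    (A * eB) * (A' * eB' * D) + (A * eB * D) * (A' * eB') by ring.
  rewrite !normrM; apply: lerD; apply: ler_pM => //.
  + by rewrite (le_trans (FA J))// ler_wpM2l// ler_expR ler_wpM2l// lerDl l1_ge0.
  + by rewrite (le_trans (GA K))// ler_wpM2l// ler_expR ler_wpM2l// lerDr l1_ge0.
Qed.

Lemma tameZ c F : tame F -> tame (fun J => c * F J).
Proof. exact/tameM/tame_cst. Qed.

Lemma tame_sum (T : Type) (r : seq T) (P : pred T) (F : T -> (I -> R) -> R) :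
  (forall t, tame (F t)) -> tame (fun J => \sum_(t <- r | P t) F t J).
Proof.
move=> tF; elim: r => [|t r IH].
  by under eq_fun do rewrite big_nil; exact: tame_cst.
under eq_fun do rewrite big_cons; case: (P t) => //; exact: tameD.
Qed.

Lemma tame_shift F i h : tame F -> tame (fun J => F (upd J i (J i + h))).
Proof.
have ls J : l1 (upd J i (J i + h)) <= l1 J + `|h|.
  rewrite /l1 (bigD1 i)//= [in leRHS](bigD1 i)//= upd_same.
  rewrite addrAC lerD ?ler_normD//.
  by apply: ler_sum => j ji; rewrite /upd (negbTE ji).
move=> [A [B [A0 B0 FA FL]]].
exists (A * expR (B * (`|h| + `|h|))), B; split => //.
- by rewrite mulr_ge0 ?expR_ge0.
- move=> J; rewrite (le_trans (FA _))// -mulrA ler_wpM2l// -expRD ler_expR.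
  rewrite -mulrDr ler_wpM2l// (le_trans (ls J))// addrC lerD2r lerDl//.
- move=> J K; rewrite (le_trans (FL _ _))//; apply: ler_pM.
  + by rewrite mulr_ge0 ?expR_ge0.
  + exact: l1_ge0.
  + rewrite -mulrA ler_wpM2l// -expRD ler_expR -mulrDr ler_wpM2l//.
    by rewrite [leRHS]addrC [leRHS]addrACA lerD.
  + apply: ler_sum => j _; rewrite /upd; case: eqVneq => [->|//].
    by rewrite opprD addrACA subrr addr0.
Qed.

Lemma continuous_of_loclip (u : R -> R) (C B : R) : 0 <= C -> 0 <= B ->
  (forall x y, `|u x - u y| <= C * expR (B * (`|x| + `|y|)) * `|x - y|) ->
  continuous u.
Proof.
move=> C0 B0 uC x; apply/cvgrPdist_le => e e0.
set D := C * expR (B * (`|x| + (`|x| + 1))) + 1.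
have D0 : 0 < D by rewrite ltr_wpDl// mulr_ge0// expR_ge0.
near=> y.
have xy1 : `|x - y| <= 1.
  by near: y; apply: (@cvgr_dist_le _ _ _ _ _ id x) => //; exact: cvg_id.
have xye : `|x - y| <= e / D.
  by near: y; apply: (@cvgr_dist_le _ _ _ _ _ id x); [exact: cvg_id|rewrite divr_gt0].
rewrite (le_trans (uC x y))//.
apply: (@le_trans _ _ (D * (e / D))); last by rewrite mulrCA divff ?mulr1 ?gt_eqF.
apply: ler_pM => //; first by rewrite mulr_ge0// expR_ge0.
have yx : `|y| <= `|x| + 1.
  by rewrite -[y](subrK x) addrC (le_trans (ler_normD _ _))// lerD2l distrC.
rewrite /D (@le_trans _ _ (C * expR (B * (`|x| + (`|x| + 1)))))// ?lerDl//.
by rewrite ler_wpM2l// ler_expR ler_wpM2l// lerD2l.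
Unshelve. all: end_near. Qed.

End tame.

(** * Iterated Gaussian means *)

Section iterated_mean.
Context {R : realType} {I : finType}.
Implicit Types (J K : I -> R) (F G : (I -> R) -> R).

Definition coord_mean (i : I) F J : R := gauss_mean (fun x => F (upd J i x)).

Lemma slice_growth F J i : tame F -> exp_growth (fun x => F (upd J i x)).
Proof.
move=> [A [B [A0 B0 FA FL]]]; split.
  apply: (@continuous_of_loclip _ _ (A * expR (B * (l1 J + l1 J))) B) => //.
    by rewrite mulr_ge0 ?expR_ge0.
  move=> x y; rewrite (le_trans (FL _ _))// l1_updB ler_wpM2r// -mulrA.
  rewrite ler_wpM2l// -expRD -mulrDr ler_expR ler_wpM2l// [leRHS]addrACA.
  by rewrite lerD// l1_upd.
exists (A * expR (B * l1 J)), B => x.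
rewrite (le_trans (FA _))// -mulrA ler_wpM2l// -expRD -mulrDr ler_expR.
by rewrite ler_wpM2l// l1_upd.
Qed.

Lemma gauss_meanB (u v : R -> R) : exp_growth u -> exp_growth v ->
  gauss_mean (fun x => u x + (-1) * v x) = gauss_mean u - gauss_mean v.
Proof.
move=> hu hv; rewrite (gauss_meanD hu (exp_growthZ (-1) hv)).
by rewrite gauss_meanZ// mulN1r.
Qed.

Lemma coord_meanD i F G J : tame F -> tame G ->
  coord_mean i (fun J => F J + G J) J = coord_mean i F J + coord_mean i G J.
Proof. by move=> tF tG; exact: gauss_meanD (slice_growth _ _ tF) (slice_growth _ _ tG). Qed.

Lemma coord_meanZ i c F J : tame F -> coord_mean i (fun J => c * F J) J = c * coord_mean i F J.
Proof. by move=> tF; exact: gauss_meanZ (slice_growth _ _ tF). Qed.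

Lemma coord_mean_le i F G J : tame F -> tame G -> (forall J, F J <= G J) ->
  coord_mean i F J <= coord_mean i G J.
Proof.
by move=> tF tG FG; apply: gauss_mean_le (slice_growth _ _ tF) (slice_growth _ _ tG) _.
Qed.

Lemma coord_mean_cst i c J : coord_mean i (fun=> c) J = c.
Proof. exact: gauss_mean_cst. Qed.

Lemma ler_norm_coord_mean i F G J : tame F -> tame G -> (forall J, `|F J| <= G J) ->
  `|coord_mean i F J| <= coord_mean i G J.
Proof.
move=> tF tG FG.
by apply: ler_norm_gauss_mean (slice_growth _ _ tF) (slice_growth _ _ tG) _.
Qed.

(** Each updated argument adds at most [|x|] to the exponent, whence the finite factor [c], the mean
    of [expR (2 B |x|)]. The rate [B] is unchanged, and so is the Lipschitz distance, since both
    points receive the same [x]. *)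
Lemma coord_mean_tame i F : tame F -> tame (coord_mean i F).
Proof.
move=> tF; have [A [B [A0 B0 FA FL]]] := tF.
pose c := gauss_mean (fun x : R => 1 * expR (B * 2 * `|x|)).
have c0 : 0 <= c.
  rewrite -(gauss_mean_cst (0 : R)); apply: gauss_mean_le.
  - exact: exp_growth_cst.
  - exact: exp_growth_expR.
  - by move=> x; rewrite mul1r expR_ge0.
exists (A * c), B; split => //; first exact: mulr_ge0.
- move=> J; rewrite mulrAC /c -gauss_meanZ; last exact: exp_growth_expR.
  apply: ler_norm_gauss_mean; first exact: slice_growth.
    exact/exp_growthZ/exp_growth_expR.
  move=> x; rewrite mul1r (le_trans (FA _))// -[leRHS]mulrA ler_wpM2l// -expRD ler_expR.
  have -> : B * l1 J + B * 2 * `|x| = B * (l1 J + 2 * `|x|) by ring.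
  rewrite ler_wpM2l// (le_trans (l1_upd _ _ _))//.
  by rewrite lerD2l ler_peMl// ler1n.
- move=> J K; set D := l1 (fun i => J i - K i).
  have -> : coord_mean i F J - coord_mean i F K =
      gauss_mean (fun x => F (upd J i x) + (-1) * F (upd K i x)).
    by rewrite (gauss_meanB (slice_growth J i tF) (slice_growth K i tF)).
  have -> : A * c * expR (B * (l1 J + l1 K)) * D =
      gauss_mean (fun x => A * expR (B * (l1 J + l1 K)) * D * (1 * expR (B * 2 * `|x|))).
    by rewrite gauss_meanZ; [rewrite /c; ring|exact: exp_growth_expR].
  apply: ler_norm_gauss_mean.
  - apply: exp_growthD; first exact: slice_growth.
    exact/exp_growthZ/slice_growth.
  - exact/exp_growthZ/exp_growth_expR.
  - move=> x; rewrite mul1r mulN1r (le_trans (FL _ _))//.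
    rewrite [leRHS]mulrAC ler_pM ?l1_updBl ?l1_ge0 ?mulr_ge0 ?expR_ge0//.
    rewrite -[leRHS]mulrA ler_wpM2l// -expRD ler_expR.
    have -> : B * (l1 J + l1 K) + B * 2 * `|x| =
      B * ((l1 J + `|x|) + (l1 K + `|x|)) by ring.
    by rewrite ler_wpM2l// lerD// l1_upd.
Qed.

Lemma avs_cons i s F J : avs (i :: s) F J = coord_mean i (avs s F) J.
Proof. by []. Qed.

Lemma avs_tame s F : tame F -> tame (avs s F).
Proof. by move=> tF; elim: s => //= i s IH; exact: coord_mean_tame. Qed.

Lemma avsD s F G J : tame F -> tame G ->
  avs s (fun J => F J + G J) J = avs s F J + avs s G J.
Proof.
move=> tF tG; elim: s J => [//|i s IH J]; rewrite !avs_cons.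
have -> : avs s (fun J => F J + G J) = fun J => avs s F J + avs s G J by exact/funext.
by rewrite coord_meanD//; exact: avs_tame.
Qed.

Lemma avsZ s c F J : tame F -> avs s (fun J => c * F J) J = c * avs s F J.
Proof.
move=> tF; elim: s J => [//|i s IH J]; rewrite !avs_cons.
have -> : avs s (fun J => c * F J) = fun J => c * avs s F J by exact/funext.
by rewrite coord_meanZ//; exact: avs_tame.
Qed.

Lemma avs_le s F G J : tame F -> tame G -> (forall J, F J <= G J) ->
  avs s F J <= avs s G J.
Proof.
move=> tF tG FG; elim: s J => //= i s IH J.
by apply: coord_mean_le => //; exact: avs_tame.
Qed.

Lemma avs_cst s c J : avs s (fun=> c) J = c.
Proof.
elim: s J => [//|i s IH J]; rewrite !avs_cons.
have -> : avs s (fun=> c) = fun=> c by exact/funext.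
exact: coord_mean_cst.
Qed.

Lemma ler_norm_avs s F G J : tame F -> tame G -> (forall J, `|F J| <= G J) ->
  `|avs s F J| <= avs s G J.
Proof.
move=> tF tG FG; elim: s J => //= i s IH J.
by apply: ler_norm_coord_mean => //; exact: avs_tame.
Qed.

(** A coordinate outside [s] is a parameter of the iterated integral and can be taken out of it. *)
Lemma avs_mul_coord s i F J : i \notin s -> tame F ->
  avs s (fun J => J i * F J) J = J i * avs s F J.
Proof.
move=> + tF; elim: s J => [//|j s IH J]; rewrite inE negb_or => /andP[ij si].
rewrite !avs_cons /coord_mean -gauss_meanZ; last first.
  exact/slice_growth/avs_tame.
by apply: gauss_mean_eq => x; rewrite IH// /upd (negbTE ij).
Qed.

Lemma avs_shift s i h F J : i \notin s ->
  avs s (fun J => F (upd J i (J i + h))) J = avs s F (upd J i (J i + h)).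
Proof.
elim: s J => [//|j s IH J]; rewrite inE negb_or => /andP[ij si].
rewrite !avs_cons /coord_mean; apply: gauss_mean_eq => x; rewrite IH//.
have -> : upd J j x i = J i by rewrite /upd (negbTE ij).
by rewrite updC// eq_sym.
Qed.

(** The coordinate [i] is integrated at its own place in [s]: the outer integrals are carried along
    by congruence, the inner ones see [J i] as a parameter. The order of integration never changes,
    and the Taylor bound passes through the inner averages with the same constant [A]. *)
Lemma avs_ibp s i F DF (A M : R) J : uniq s -> i \in s -> tame F -> tame DF ->
  (forall J, `|F J| <= M) ->
  (forall J h, `|F (upd J i (J i + h)) - F J - h * DF J| <= A * h ^+ 2) ->
  avs s (fun J => J i * F J) J = avs s DF J.
Proof.
move=> + + tF tDF FM taylor; have tc := tame_cst (I := I).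
elim: s J => [//|j s IH J] /andP[js us]; rewrite inE !avs_cons; case: eqVneq => [ij _|_ si].
  rewrite -ij in js.
  have tU := avs_tame s tF; have tV := avs_tame s tDF.
  rewrite -ij /coord_mean.
  transitivity (gauss_mean (fun x => x * avs s F (upd J i x))).
    by apply: gauss_mean_eq => x; rewrite avs_mul_coord// upd_same.
  have shE h x : avs s F (upd J i (x + h)) =
      avs s (fun J => F (upd J i (J i + h))) (upd J i x).
    by rewrite avs_shift// upd_same upd_upd.
  apply: (@gauss_ibp _ _ _ A M).
  - exact: slice_growth.
  - exact: slice_growth.
  - have := slice_growth J i (tameM (tame_coord i) tU).
    by under eq_fun do rewrite upd_same.
  - move=> h; under eq_fun do rewrite shE.
    exact/slice_growth/avs_tame/tame_shift.
  - by move=> x; rewrite -[leRHS](avs_cst s M (upd J i x)); exact: ler_norm_avs.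
  - move=> x h; rewrite shE.
    have -> : avs s (fun J => F (upd J i (J i + h))) (upd J i x) -
        avs s F (upd J i x) - h * avs s DF (upd J i x) =
        avs s (fun J => F (upd J i (J i + h)) + ((-1) * F J + (- h) * DF J)) (upd J i x).
      rewrite avsD; first last.
      - by apply: tameD; exact: tameZ.
      - exact: tame_shift.
      rewrite avsD ?avsZ//; try exact: tameZ.
      by ring.
    rewrite -[leRHS](avs_cst s (A * h ^+ 2) (upd J i x)); apply: ler_norm_avs => //.
      apply: tameD; first exact: tame_shift.
      by apply: tameD; exact: tameZ.
    by move=> K; rewrite mulN1r mulNr addrA.
by apply: gauss_mean_eq => x; exact: IH.
Qed.

(** One constant per coordinate, because the variance bound sums their squares, and this sum is what
    stability controls. *)
Definition coord_lip (L : I -> R) F :=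
  forall J i x, `|F (upd J i x) - F J| <= L i * `|x - J i|.

Lemma coord_mean_coord_lip L F i : tame F -> coord_lip L F -> coord_lip L (coord_mean i F).
Proof.
move=> tF FL J j x; have [<-|ij] := eqVneq i j.
  rewrite /coord_mean; under gauss_mean_eq do rewrite upd_upd.
  rewrite subrr normr0.
  (* The left side is 0, so only [0 <= L i] is missing; it is read off the hypothesis at a point
     where [x - J i] is nonzero. *)
  have [->|xJ] := eqVneq x (J i); first by rewrite subrr normr0 mulr0.
  rewrite mulr_ge0// -(@pmulr_lge0 _ `|x - J i|) ?normr_gt0 ?subr_eq0//.
  by rewrite (le_trans _ (FL J i x)).
have -> : coord_mean i F (upd J j x) - coord_mean i F J =
   gauss_mean (fun y => F (upd (upd J j x) i y) + (-1) * F (upd J i y)).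
  by rewrite (gauss_meanB (slice_growth _ i tF) (slice_growth J i tF)).
rewrite -[leRHS]gauss_mean_cst; apply: ler_norm_gauss_mean.
- by apply: exp_growthD; [exact: slice_growth|exact/exp_growthZ/slice_growth].
- exact: exp_growth_cst.
- move=> y; rewrite mulN1r updC 1?eq_sym//.
  have := FL (upd J i y) j x.
  by rewrite [upd J i y j]/upd eq_sym (negbTE ij).
Qed.

Lemma avs_coord_lip L F s : tame F -> coord_lip L F -> coord_lip L (avs s F).
Proof.
move=> tF FL; elim: s => //= i s IH.
by apply: coord_mean_coord_lip => //; exact: avs_tame.
Qed.

(* Tensorization of the variance; in one variable
   [Var U <= E (U - U 0) ^+ 2 <= L ^+ 2 * E g ^+ 2]. *)
Lemma avs_variance L F s J : tame F -> coord_lip L F ->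
  avs s (fun J => F J ^+ 2) J - (avs s F J) ^+ 2 <=
  gauss_mean (fun x : R => x ^+ 2) * \sum_(i <- s) L i ^+ 2.
Proof.
move=> tF FL; set k := gauss_mean _.
have tF2 : tame (fun J => F J ^+ 2) by under eq_fun do rewrite expr2; exact: tameM.
elim: s J => [|i s IH] J; first by rewrite big_nil mulr0 /= subrr.
rewrite big_cons !avs_cons mulrDr.
have tU := avs_tame s tF.
have tU2 : tame (fun J => avs s F J ^+ 2) by under eq_fun do rewrite expr2; exact: tameM.
set S := k * _ in IH *.
(* Total variance: [h1] bounds the mean of the conditional variance by induction, [h2] the variance
   of the conditional mean. *)
have h1 : coord_mean i (avs s (fun J => F J ^+ 2)) J <=
    coord_mean i (fun J => avs s F J ^+ 2) J + S.
  rewrite -[S in leRHS](coord_mean_cst i S J) -coord_meanD//; last exact: tame_cst.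
  apply: coord_mean_le; [exact: avs_tame|by apply: tameD => //; exact: tame_cst|].
  by move=> K; rewrite -lerBlDl.
suff h2 : coord_mean i (fun J => avs s F J ^+ 2) J - coord_mean i (avs s F) J ^+ 2 <= k * L i ^+ 2.
  by lra.
set U := avs s F in tU tU2 *; set a := U (upd J i 0).
have UL : coord_lip L U by exact: avs_coord_lip.
have hx2 : exp_growth (fun x : R => x ^+ 2).
  have := slice_growth J i (tameM (tame_coord i) (tame_coord i)).
  by under eq_fun do rewrite upd_same -expr2.
have tUa : tame (fun J => (-2 * a) * U J + a ^+ 2).
  by apply: tameD; [exact: tameZ|exact: tame_cst].
have tc := tame_cst (I := I) (a ^+ 2).
have h3 : coord_mean i (fun J => U J ^+ 2 + ((-2 * a) * U J + a ^+ 2)) J <= k * L i ^+ 2.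
  rewrite [leRHS]mulrC /k -gauss_meanZ//; apply: gauss_mean_le.
  - by have := slice_growth J i (tameD tU2 tUa).
  - exact: exp_growthZ.
  - move=> x; rewrite -/(upd J i x).
    have -> : U (upd J i x) ^+ 2 + ((-2 * a) * U (upd J i x) + a ^+ 2) =
       `|U (upd J i x) - a| ^+ 2 by rewrite real_normK ?num_real//; ring.
    have := UL (upd J i 0) i x; rewrite upd_upd upd_same subr0 -/a => h.
    have -> : L i ^+ 2 * x ^+ 2 = (L i * `|x|) ^+ 2.
      by rewrite exprMn real_normK ?num_real.
    rewrite lerXn2r// nnegrE// (le_trans _ h)//.
move: h3; rewrite (coord_meanD i J tU2 tUa) (coord_meanD i J (tameZ (-2 * a) tU) tc).
rewrite coord_meanZ// coord_mean_cst.
have := sqr_ge0 (coord_mean i U J - a).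
by rewrite expr2; lra.
Qed.

End iterated_mean.

(** * Finite Gibbs averages *)

Section gibbs.
Context {R : realType} {S : finType}.
Implicit Types (th et f g : S -> R).

Definition gibZ th : R := \sum_s expR (th s).

(** Here [th] is the whole exponent of the Boltzmann weight, with sign and temperature included. *)
Definition gib th f : R := (\sum_s f s * expR (th s)) / gibZ th.

Lemma gibZ_gt0 (s0 : S) th : 0 < gibZ th.
Proof.
rewrite /gibZ (bigD1 s0)//= ltr_pwDl ?expR_gt0// sumr_ge0//.
Qed.

Lemma gibD th f g : gib th (fun s => f s + g s) = gib th f + gib th g.
Proof.
rewrite /gib -mulrDl -big_split/=; congr (_ / _).
by apply: eq_bigr => s _; rewrite mulrDl.
Qed.

Lemma gibZl th c f : gib th (fun s => c * f s) = c * gib th f.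
Proof.
rewrite /gib mulrA mulr_sumr; congr (_ / _).
by apply: eq_bigr => s _; rewrite mulrA.
Qed.

Lemma gib_eq th f g : f =1 g -> gib th f = gib th g.
Proof. by move=> /funext ->. Qed.

Lemma gib_cst (s0 : S) th c : gib th (fun=> c) = c.
Proof. by rewrite /gib -mulr_sumr mulfK// gt_eqF// (gibZ_gt0 s0). Qed.

Lemma gib_sum (T : Type) (r : seq T) (P : pred T) th (F : T -> S -> R) :
  gib th (fun s => \sum_(t <- r | P t) F t s) = \sum_(t <- r | P t) gib th (F t).
Proof.
elim: r => [|t r IH].
  rewrite big_nil -[RHS](mul0r (gib th (fun=> 0))) -gibZl; apply: gib_eq => s.
  by rewrite big_nil mulr0.
rewrite big_cons -IH; case: ifPn => Pt; last first.
  by apply: gib_eq => s; rewrite big_cons (negbTE Pt).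
by rewrite -gibD; apply: gib_eq => s; rewrite big_cons Pt.
Qed.

Lemma gib_le (s0 : S) th f g : (forall s, f s <= g s) -> gib th f <= gib th g.
Proof.
move=> fg; apply: ler_wpM2r; first by rewrite invr_ge0 ltW// (gibZ_gt0 s0).
by apply: ler_sum => s _; rewrite ler_wpM2r// expR_ge0.
Qed.

Lemma ler_norm_gib (s0 : S) th f (M : R) : (forall s, `|f s| <= M) ->
  `|gib th f| <= M.
Proof.
move=> fM; rewrite -[leRHS](gib_cst s0 th M) ler_norml; apply/andP; split.
  rewrite -mulN1r -gibZl; apply: (gib_le s0) => s; rewrite mulN1r.
  by have := fM s; rewrite ler_norml => /andP[].
by apply: (gib_le s0) => s; have := fM s; rewrite ler_norml => /andP[].
Qed.

Lemma is_derive_bigsum (T : Type) (r : seq T) (F : T -> R -> R) (dF : T -> R) (x : R) :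
  (forall t, is_derive x 1 (F t) (dF t)) ->
  is_derive x 1 (fun u => \sum_(t <- r) F t u) (\sum_(t <- r) dF t).
Proof.
move=> H; elim: r => [|t r IH].
  by under eq_fun do rewrite big_nil; rewrite big_nil; exact: is_derive_cst.
by under eq_fun do rewrite big_cons; rewrite big_cons; exact: is_deriveD.
Qed.

Lemma is_derive_expR_affine (a b c x : R) :
  is_derive x 1 (fun u => c * expR (a + u * b)) (c * b * expR (a + x * b)).
Proof.
have h1 : is_derive x 1 (fun u : R => a + u * b) b.
  have -> : (fun u : R => a + u * b) = (cst a + (b *: id)).
    by apply/funext => u; rewrite !fctE /= mulrC.
  have := is_deriveD (is_derive_cst a x (1 : R)) (is_deriveZ b (is_derive_id x (1 : R))).
  by rewrite add0r /GRing.scale/= mulr1.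
have h2 : is_derive x 1 (expR \o (fun u : R => a + u * b)) (expR (a + x * b) * b).
  by apply: is_derive1_comp.
have -> : (fun u => c * expR (a + u * b)) = c *: (expR \o (fun u : R => a + u * b)).
  by [].
have := is_deriveZ c h2; rewrite /GRing.scale/=.
by rewrite (mulrC (expR _)) mulrA.
Qed.

(** By the quotient rule, the derivative is the Gibbs covariance of [f] and the direction [et]. *)
Lemma is_derive_gib (s0 : S) th et f (x : R) :
  is_derive x (1 : R) (fun u : R => gib (fun s => th s + u * et s) f)
   (gib (fun s => th s + x * et s) (fun s => f s * et s)
    - gib (fun s => th s + x * et s) f * gib (fun s => th s + x * et s) et).
Proof.
have hn g : is_derive x 1 (fun u => \sum_s g s * expR (th s + u * et s))
    (\sum_s g s * et s * expR (th s + x * et s)).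
  by apply: is_derive_bigsum => s; exact: is_derive_expR_affine.
have hZ : is_derive x 1 (fun u => gibZ (fun s => th s + u * et s))
    (\sum_s et s * expR (th s + x * et s)).
  have := hn (fun=> 1); rewrite /gibZ.
  under eq_fun do under eq_bigr do rewrite mul1r.
  by under [X in is_derive _ _ _ X]eq_bigr do rewrite mul1r.
have Z0 : gibZ (fun s => th s + x * et s) != 0 by rewrite gt_eqF// (gibZ_gt0 s0).
have hV := is_deriveV Z0 hZ.
have E : (fun u => gib (fun s => th s + u * et s) f) =
    (fun u => \sum_s f s * expR (th s + u * et s)) *
    (fun u => (gibZ (fun s => th s + u * et s))^-1) by [].
rewrite E; apply: (is_derive_eq (is_deriveM (hn f) hV)).
rewrite /gib /GRing.scale/=; field.
exact: Z0.
Qed.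

Lemma mvt_unit (phi dphi : R -> R) (a : R) :
  (forall x, is_derive x (1 : R) phi (dphi x)) ->
  exists2 c, `|c| <= `|a| & phi a - phi 0 = dphi c * a.
Proof.
move=> H.
have cphi : continuous phi.
  move=> x; apply/differentiable_continuous/derivable1_diffP.
  exact: ex_derive.
have [a0|a0] := leP 0 a.
  have [//|c] := @MVT_segment R phi dphi 0 a a0 (fun x _ => H x).
    exact: continuous_subspaceT.
  rewrite in_itv/= => /andP[c0 ca] E; exists c; last by rewrite E subr0.
  by rewrite !ger0_norm.
have [//|c] := @MVT_segment R phi dphi a 0 (ltW a0) (fun x _ => H x).
  exact: continuous_subspaceT.
rewrite in_itv/= => /andP[ac c0] E; exists c.
  by rewrite !ler0_norm ?lerN2// ltW.
by rewrite -[LHS]opprB E sub0r mulrN opprK.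
Qed.

(** Mean value theorem on the segment from [th] to [th']: the covariance of functions bounded by [M]
    and [L] is at most [2 M L]. *)
Lemma gib_lip (s0 : S) th th' f (M L : R) : (forall s, `|f s| <= M) ->
  (forall s, `|th' s - th s| <= L) -> `|gib th' f - gib th f| <= 2 * M * L.
Proof.
move=> fM tL; pose et s := th' s - th s.
have [c _] := mvt_unit 1 (is_derive_gib s0 th et f).
set g := gib _ _ - gib _ _.
have -> : g = gib th' f - gib th f.
  congr (gib _ _ - gib _ _); apply/funext => s; rewrite /et; ring.
rewrite mulr1 => ->; rewrite (le_trans (ler_normB _ _))//.
have L0 : 0 <= L by rewrite (le_trans _ (tL s0)).
rewrite -mulrA mulr2n mulrDl mul1r lerD//.
  by apply: (ler_norm_gib s0) => s; rewrite normrM ler_pM// tL.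
by rewrite normrM ler_pM//; apply: (ler_norm_gib s0).
Qed.

(** Two uses of the mean value theorem. The second derivative is a signed sum of six products of
    Gibbs means, each at most [M L^2], hence the 6. *)
Lemma gib_taylor (s0 : S) th et f (M L u : R) : (forall s, `|f s| <= M) ->
  (forall s, `|et s| <= L) ->
  `|gib (fun s => th s + u * et s) f - gib th f -
    u * (gib th (fun s => f s * et s) - gib th f * gib th et)| <=
  6 * M * L ^+ 2 * u ^+ 2.
Proof.
move=> fM eL.
have L0 : 0 <= L by rewrite (le_trans _ (eL s0)).
have M0 : 0 <= M by rewrite (le_trans _ (fM s0)).
pose thu u s := th s + u * et s.
have thu0 : thu 0 = th by apply/funext => s; rewrite /thu mul0r addr0.
have feM s : `|f s * et s| <= M * L by rewrite normrM ler_pM.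
have eeL s : `|et s * et s| <= L * L by rewrite normrM ler_pM.
have feeM s : `|f s * et s * et s| <= M * L * L by rewrite normrM ler_pM.
have [c ca] := mvt_unit u (is_derive_gib s0 th et f).
rewrite -!/(thu _) thu0 => ->.
pose psi x := gib (thu x) (fun s => f s * et s) - gib (thu x) f * gib (thu x) et.
have dpsi x : is_derive x (1 : R) psi
    ((gib (thu x) (fun s => f s * et s * et s)
      - gib (thu x) (fun s => f s * et s) * gib (thu x) et)
     - (gib (thu x) f * (gib (thu x) (fun s => et s * et s) - gib (thu x) et * gib (thu x) et)
       + gib (thu x) et * (gib (thu x) (fun s => f s * et s) - gib (thu x) f * gib (thu x) et))).
  have h1 := is_derive_gib s0 th et (fun s => f s * et s) x.
  have h2 := is_derive_gib s0 th et f x.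
  have h3 := is_derive_gib s0 th et et x.
  exact: (is_deriveB h1 (is_deriveM h2 h3)).
have [c' _ psiE] := mvt_unit c dpsi.
move: psiE; set D := (X in _ = X * c) => psiE.
rewrite -/(psi c).
have -> : gib th (fun s => f s * et s) - gib th f * gib th et = psi 0.
  by rewrite /psi thu0.
have -> : psi c * u - u * psi 0 = (psi c - psi 0) * u by ring.
have nb g (K : R) x : (forall s, `|g s| <= K) -> `|gib (thu x) g| <= K.
  exact: ler_norm_gib.
have D6 : `|D| <= 6 * M * L ^+ 2.
  have -> : 6 * M * L ^+ 2 = (M * L * L + M * L * L) +
     (M * (L * L + L * L) + L * (M * L + M * L)) by ring.
  have nbM g g' (K K' : R) x : (forall s, `|g s| <= K) -> (forall s, `|g' s| <= K') ->
      `|gib (thu x) g * gib (thu x) g'| <= K * K'.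
    by move=> gK gK'; rewrite normrM ler_pM ?nb.
  have nbB (a b K K' : R) : `|a| <= K -> `|b| <= K' -> `|a - b| <= K + K'.
    by move=> aK bK'; rewrite (le_trans (ler_normB _ _)) ?lerD.
  apply: (nbB _ _ _ _); first by apply: (nbB _ _ _ _); [exact: nb|exact: nbM].
  rewrite (le_trans (ler_normD _ _))//; apply: lerD; rewrite normrM; apply: ler_pM => //.
  - exact: nb.
  - by apply: (nbB _ _ _ _); [exact: nb|exact: nbM].
  - exact: nb.
  - by apply: (nbB _ _ _ _); [exact: nb|exact: nbM].
rewrite psiE !normrM -mulrA ler_pM ?mulr_ge0//.
by rewrite -(real_normK (num_real u)) expr2 ler_pM.
Qed.

(** Jensen's inequality: the ratio of partition functions is the Gibbs mean of [expR (et s)], and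
    the tangent of the exponential at [m = gib th et] lies below it. This is convexity of [ln Z] in
    tangent form. *)
Lemma ln_gibZ_ge (s0 : S) th et :
  ln (gibZ th) + gib th et <= ln (gibZ (fun s => th s + et s)).
Proof.
have Z0 := gibZ_gt0 s0.
have -> : gibZ (fun s => th s + et s) = gibZ th * gib th (fun s => expR (et s)).
  rewrite /gib mulrCA mulfV ?mulr1 ?gt_eqF//.
  by apply: eq_bigr => s _; rewrite expRD mulrC.
have g1 : expR (gib th et) <= gib th (fun s => expR (et s)).
  pose m := gib th et; rewrite -/m.
  have -> : expR m = gib th (fun s => expR m * (1 + (-1) * m + et s)).
    by rewrite gibZl gibD gib_cst// -/m; ring.
  apply: (gib_le s0) => s.
  have := expR_ge1Dx (et s - m); rewrite -(ler_pM2l (expR_gt0 m)) -expRD.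
  have -> : m + (et s - m) = et s by ring.
  by apply: le_trans; rewrite ler_wpM2l ?expR_ge0//; lra.
have g0 : 0 < gib th (fun s => expR (et s)) by rewrite (lt_le_trans _ g1)// expR_gt0.
rewrite lnM ?posrE// lerD2l -[leLHS]expRK ler_ln ?posrE// expR_gt0//.
Qed.

Lemma ln_gibZ_lip (s0 : S) th th' (L : R) : (forall s, `|th' s - th s| <= L) ->
  `|ln (gibZ th') - ln (gibZ th)| <= L.
Proof.
have half (a b : S -> R) : (forall s, `|b s - a s| <= L) -> ln (gibZ a) - L <= ln (gibZ b).
  move=> abL; have := ln_gibZ_ge s0 a (fun s => b s - a s).
  have -> : (fun s => a s + (b s - a s)) = b by apply/funext => s; ring.
  apply: le_trans; rewrite lerD2l.
  by have := ler_norm_gib s0 a abL; rewrite ler_norml => /andP[].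
move=> tL; rewrite ler_norml; apply/andP; split.
  by have := half th th' tL; lra.
have := half th' th; rewrite lerBlDr => h; rewrite lerBlDr addrC; apply: h => s.
by rewrite distrC.
Qed.

End gibbs.

(** * Replicas *)

Section replicas.
Context {R : realType} {T : finType} (t0 : T).
Implicit Types (th et f : T -> R) (n : nat) (Phi Psi : (nat -> T) -> R).

(** Prolongs a tuple to an infinite sequence with the default [t0]. The form is that of [rep], with
    which it agrees when [t0] is the all-plus configuration. *)
Definition replica n (ss : {ffun 'I_n -> T}) (k : nat) : T :=
  odflt t0 (omap ss (insub k)).

Definition energy n th (ss : {ffun 'I_n -> T}) : R := \sum_(i < n) th (ss i).

(** The product state is again a [gib], on tuples, so the estimates for one system carry over to
    replicas. *)
Definition rgib n th Phi : R := gib (@energy n th) (fun ss => Phi (replica ss)).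

Definition depends_below n Phi := forall u v : nat -> T,
  (forall k, (k < n)%N -> u k = v k) -> Phi u = Phi v.

Definition extend n (ss : {ffun 'I_n -> T}) (t : T) : {ffun 'I_n.+1 -> T} :=
  [ffun i => if unlift ord_max i is Some j then ss j else t].

Lemma big_ffun_recr n (F : {ffun 'I_n.+1 -> T} -> R) :
  \sum_ss F ss = \sum_(ss : {ffun 'I_n -> T}) \sum_t F (extend ss t).
Proof.
rewrite pair_big /=.
pose split (ss : {ffun 'I_n.+1 -> T}) : {ffun 'I_n -> T} * T :=
  ([ffun j => ss (lift ord_max j)], ss ord_max).
rewrite (reindex (fun p : {ffun 'I_n -> T} * T => extend p.1 p.2))//=.
exists split => [[ss t] _|ss _].
  congr pair; last by rewrite ffunE unlift_none.
  by apply/ffunP => j; rewrite !ffunE liftK.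
apply/ffunP => i; rewrite !ffunE /=; case: unliftP => [j ->|->//].
by rewrite ffunE.
Qed.

Lemma extend_widen n (ss : {ffun 'I_n -> T}) t (i : 'I_n) :
  extend ss t (widen_ord (leqnSn n) i) = ss i.
Proof.
rewrite ffunE; have -> : widen_ord (leqnSn n) i = lift ord_max i.
  by apply/val_inj; rewrite /= /bump leqNgt ltn_ord.
by rewrite liftK.
Qed.

Lemma energy_extend n th (ss : {ffun 'I_n -> T}) t :
  energy th (extend ss t) = energy th ss + th t.
Proof.
rewrite /energy big_ord_recr/=; congr (_ + th _); last first.
  by rewrite ffunE unlift_none.
by apply: eq_bigr => i _; rewrite extend_widen.
Qed.

Lemma replicaE n (ss : {ffun 'I_n -> T}) (i : 'I_n) : replica ss i = ss i.
Proof. by rewrite /replica valK. Qed.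

Lemma replica_extend n (ss : {ffun 'I_n -> T}) t :
  replica (extend ss t) = upd (replica ss) n t.
Proof.
apply/funext => k; rewrite /upd; case: eqVneq => [->|kn].
  by rewrite -[X in replica _ X]/(val (@ord_max n)) replicaE ffunE unlift_none.
have [kn'|kn'] := ltnP k n.
  rewrite -[k in LHS]/(val (widen_ord (leqnSn n) (Ordinal kn'))) replicaE extend_widen.
  by rewrite -[k in RHS]/(val (Ordinal kn')) replicaE.
rewrite /replica !insubN// -leqNgt//.
by rewrite ltn_neqAle eq_sym kn.
Qed.

Lemma gibZ_energyS n th :
  gibZ (@energy n.+1 th) = gibZ (@energy n th) * gibZ th.
Proof.
rewrite /gibZ big_ffun_recr mulr_suml; apply: eq_bigr => ss _.
rewrite mulr_sumr; apply: eq_bigr => t _.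
by rewrite energy_extend expRD.
Qed.

Lemma gibZ_energy n th : gibZ (@energy n th) = gibZ th ^+ n.
Proof.
elim: n => [|n IH]; last by rewrite gibZ_energyS IH exprSr.
rewrite expr0 /gibZ (eq_bigr (fun=> 1)) => [|ss _]; last first.
  by rewrite /energy big_ord0 expR0.
by rewrite sumr_const card_ffun card_ord expn0.
Qed.

(** Sums over the last replica first; marginalization, independence and the sum over replicas all
    come from this recursion. *)
Lemma rgibS n th Phi :
  rgib n.+1 th Phi = rgib n th (fun u => gib th (fun t => Phi (upd u n t))).
Proof.
rewrite /rgib /gib gibZ_energyS big_ffun_recr invfM mulrCA [LHS]mulrC.
congr (_ * _); rewrite mulr_suml; apply: eq_bigr => ss _.
rewrite [RHS]mulrAC; congr (_ * _); rewrite mulr_suml; apply: eq_bigr => t _.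
by rewrite energy_extend expRD replica_extend mulrA mulrAC.
Qed.

Lemma rgibD n th Phi Psi :
  rgib n th (fun u => Phi u + Psi u) = rgib n th Phi + rgib n th Psi.
Proof. exact: gibD. Qed.

Lemma rgibZl n th a Phi : rgib n th (fun u => a * Phi u) = a * rgib n th Phi.
Proof. exact: gibZl. Qed.

Lemma rgib_sum (S : Type) (r : seq S) (P : pred S) n th (F : S -> (nat -> T) -> R) :
  rgib n th (fun u => \sum_(s <- r | P s) F s u) = \sum_(s <- r | P s) rgib n th (F s).
Proof. by rewrite /rgib -gib_sum. Qed.

Lemma rgib_eq n th Phi Psi : Phi =1 Psi -> rgib n th Phi = rgib n th Psi.
Proof. by move=> /funext ->. Qed.

Lemma rgib_marg n th Phi : depends_below n Phi -> rgib n.+1 th Phi = rgib n th Phi.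
Proof.
move=> dP; rewrite rgibS; apply: rgib_eq => u.
rewrite -[RHS](gib_cst t0 th); apply: gib_eq => t; apply: dP => k kn.
by rewrite /upd ltn_eqF.
Qed.

(** Turns a product of Gibbs means with the same disorder into one mean with a fresh replica; this
    is how replica n + 1 enters the identities. *)
Lemma rgib_indep n th Phi f : depends_below n Phi ->
  rgib n.+1 th (fun u => Phi u * f (u n)) = rgib n th Phi * gib th f.
Proof.
move=> dP; rewrite rgibS mulrC -rgibZl; apply: rgib_eq => u.
rewrite mulrC -gibZl; apply: gib_eq => t; rewrite upd_same; congr (_ * _).
by apply: dP => j jn; rewrite /upd ltn_eqF.
Qed.

Lemma rgib1 th f : rgib 1 th (fun u => f (u 0%N)) = gib th f.
Proof.
rewrite rgibS /rgib.
under gib_eq do under gib_eq do rewrite upd_same.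
by apply: gib_cst; exact: [ffun=> t0].
Qed.

Lemma rgib_sum_replicas n th f :
  rgib n th (fun u => \sum_(i < n) f (u i)) = n%:R * gib th f.
Proof.
elim: n => [|n IH].
  under rgib_eq do rewrite big_ord0.
  by rewrite mul0r; apply: gib_cst; exact: [ffun=> t0].
rewrite rgibS -natr1 mulrDl mul1r -IH.
have -> : gib th f = rgib n th (fun=> gib th f).
  by rewrite /rgib gib_cst//; exact: [ffun=> t0].
rewrite -rgibD; apply: rgib_eq => u.
rewrite -[X in X + _](gib_cst t0 th) -gibD; apply: gib_eq => t.
rewrite big_ord_recr/= upd_same; congr (_ + _); apply: eq_bigr => i _.
by rewrite /upd ltn_eqF.
Qed.

Lemma ler_norm_rgib n th Phi (M : R) : (forall u, `|Phi u| <= M) ->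
  `|rgib n th Phi| <= M.
Proof. by move=> PM; apply: (ler_norm_gib [ffun=> t0]). Qed.

Lemma rgib_lip n th th' Phi (M L : R) : (forall u, `|Phi u| <= M) ->
  (forall t, `|th' t - th t| <= L) ->
  `|rgib n th' Phi - rgib n th Phi| <= 2 * M * (n%:R * L).
Proof.
move=> PM tL; apply: (gib_lip [ffun=> t0]) => // ss.
rewrite /energy -sumrB (le_trans (ler_norm_sum _ _ _))//.
rewrite (le_trans (ler_sum _ (fun i _ => tL (ss i))))//.
by rewrite sumr_const card_ord mulr_natl.
Qed.

(** [gib_taylor] on tuples, where the direction becomes a sum over n replicas bounded by [n L]. The
    product of means in the covariance is rewritten with a fresh replica. *)
Lemma rgib_taylor n th et Phi (M L u : R) : depends_below n Phi ->
  (forall u, `|Phi u| <= M) -> (forall t, `|et t| <= L) ->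
  `|rgib n (fun t => th t + u * et t) Phi - rgib n th Phi
    - u * (rgib n th (fun v => Phi v * \sum_(i < n) et (v i))
           - n%:R * rgib n.+1 th (fun v => Phi v * et (v n)))|
  <= 6 * M * (n%:R * L) ^+ 2 * u ^+ 2.
Proof.
move=> dP PM eL.
have e1 (ss : {ffun 'I_n -> T}) : energy et ss = \sum_(i < n) et (replica ss i).
  by apply: eq_bigr => i _; rewrite replicaE.
have -> : rgib n th (fun v => Phi v * \sum_(i < n) et (v i))
           - n%:R * rgib n.+1 th (fun v => Phi v * et (v n)) =
    gib (@energy n th) (fun ss => Phi (replica ss) * energy et ss)
    - gib (@energy n th) (fun ss => Phi (replica ss)) * gib (@energy n th) (@energy n et).
  rewrite rgib_indep// mulrCA -rgib_sum_replicas; congr (_ - _ * _).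
    by apply: gib_eq => ss; rewrite e1.
  by apply: gib_eq => ss; rewrite e1.
have -> : rgib n (fun t => th t + u * et t) Phi =
    gib (fun ss => @energy n th ss + u * energy et ss) (fun ss => Phi (replica ss)).
  rewrite /rgib; congr (gib _ _); apply/funext => ss.
  by rewrite /energy mulr_sumr -big_split.
apply: (gib_taylor [ffun=> t0]) => // ss.
rewrite /energy (le_trans (ler_norm_sum _ _ _))//.
rewrite (le_trans (ler_sum _ (fun i _ => eL (ss i))))//.
by rewrite sumr_const card_ord mulr_natl.
Qed.

End replicas.

(** * Gaussian random fields on a finite set *)

Section gaussian_mean.
Context {R : realType} {I : finType}.
Implicit Types (F G : (I -> R) -> R).

Lemma AvD F G : tame F -> tame G -> Av (fun g => F g + G g) = Av F + Av G.
Proof. by move=> tF tG; exact: avsD. Qed.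

Lemma AvZ a F : tame F -> Av (fun g => a * F g) = a * Av F.
Proof. by move=> tF; exact: avsZ. Qed.

Lemma AvB F G : tame F -> tame G -> Av (fun g => F g - G g) = Av F - Av G.
Proof.
move=> tF tG; rewrite -mulN1r -AvZ// -AvD//; last exact: tameZ.
by congr Av; apply/funext => g; rewrite mulN1r.
Qed.

Lemma Av_le F G : tame F -> tame G -> (forall g, F g <= G g) -> Av F <= Av G.
Proof. by move=> tF tG FG; exact: avs_le. Qed.

Lemma ler_norm_Av F G : tame F -> tame G -> (forall g, `|F g| <= G g) ->
  `|Av F| <= Av G.
Proof. by move=> tF tG FG; exact: ler_norm_avs. Qed.

Lemma Av_cst (a : R) : Av (fun _ : I -> R => a) = a.
Proof. exact: avs_cst. Qed.

Lemma Av_sum (S : Type) (r : seq S) (P : pred S) (F : S -> (I -> R) -> R) :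
  (forall s, tame (F s)) ->
  Av (fun g => \sum_(s <- r | P s) F s g) = \sum_(s <- r | P s) Av (F s).
Proof.
move=> tF; elim: r => [|s r IH].
  by under eq_fun do rewrite big_nil; rewrite big_nil Av_cst.
under eq_fun do rewrite big_cons; rewrite big_cons -IH.
by case: (P s) => //; rewrite AvD//; exact: tame_sum.
Qed.

End gaussian_mean.

(** * Quenched replica means for a Gaussian field on a finite state space *)

Section model.
Context {R : realType} {T I : finType} (t0 : T) (c : I -> R) (sg : I -> T -> R).
Hypothesis sg1 : forall i t, `|sg i t| <= 1.
Implicit Types (g : I -> R) (Phi Psi : (nat -> T) -> R) (n : nat) (b : R).

(** The [h] of the overview: minus the Hamiltonian, with the standard deviations [c i] made
    explicit. *)
Definition field g t : R := \sum_i c i * g i * sg i t.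

Definition tilt b g t : R := b * field g t.

Definition mean b n Phi : R := Av (fun g => rgib t0 n (tilt b g) Phi).

Definition bdd Phi := exists M : R, forall u, `|Phi u| <= M.

Lemma bddM Phi Psi : bdd Phi -> bdd Psi -> bdd (fun u => Phi u * Psi u).
Proof.
by move=> [M PM] [M' PM']; exists (M * M') => u; rewrite normrM ler_pM.
Qed.

Lemma bdd_sum (S : Type) (r : seq S) (P : pred S) (F : S -> (nat -> T) -> R) :
  (forall s, bdd (F s)) -> bdd (fun u => \sum_(s <- r | P s) F s u).
Proof.
move=> bF; elim: r => [|s r [M IH]].
  by exists 0 => u; rewrite big_nil normr0.
have [K FK] := bF s; have K0 : 0 <= K by rewrite (le_trans _ (FK (fun=> t0))).
exists (K + M) => u; rewrite big_cons; case: (P s).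
  by rewrite (le_trans (ler_normD _ _))// lerD.
by rewrite (le_trans (IH u))// lerDr.
Qed.

Lemma bdd_fin (f : T -> R) k : bdd (fun u => f (u k)).
Proof.
exists (\sum_t `|f t|) => u; rewrite (bigD1 (u k))//= lerDl sumr_ge0//.
Qed.

Lemma bdd_fin2 (f : T -> T -> R) k l : bdd (fun u => f (u k) (u l)).
Proof.
exists (\sum_t \sum_t' `|f t t'|) => u; rewrite (bigD1 (u k))//=.
rewrite (bigD1 (u l))//= -addrA lerDl addr_ge0// ?sumr_ge0// => t _.
by rewrite sumr_ge0.
Qed.

(** Bounds the field uniformly over configurations while staying tame in [g], so it can serve as an
    integrable Taylor or Lipschitz constant. *)
Definition field_bound g : R := \sum_i `|c i| * `|g i|.

Lemma ler_field g t : `|field g t| <= field_bound g.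
Proof.
rewrite (le_trans (ler_norm_sum _ _ _))// ler_sum// => i _.
by rewrite !normrM -[leRHS]mulr1 ler_pM.
Qed.

Lemma tame_field_bound : tame field_bound.
Proof. by apply: tame_sum => i; apply/tameZ/tame_norm/tame_coord. Qed.

Lemma fieldB g g' t : field g t - field g' t = field (fun i => g i - g' i) t.
Proof.
rewrite /field -sumrB; apply: eq_bigr => i _; ring.
Qed.

Lemma field_bound_l1 g : field_bound g <= (\sum_i `|c i|) * l1 g.
Proof.
rewrite mulr_suml ler_sum// => i _; rewrite ler_wpM2l//; exact: ler_l1.
Qed.

Lemma tilt_lip b g g' t :
  `|tilt b g t - tilt b g' t| <= `|b| * (\sum_i `|c i|) * l1 (fun i => g i - g' i).
Proof.
rewrite /tilt -mulrBr fieldB normrM -mulrA ler_wpM2l//.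
by rewrite (le_trans (ler_field _ _))// field_bound_l1.
Qed.

Lemma tame_rgib b n Phi : bdd Phi -> tame (fun g => rgib t0 n (tilt b g) Phi).
Proof.
move=> [M PM].
apply: (@tame_lip _ _ _ M (2 * M * (n%:R * (`|b| * \sum_i `|c i|)))).
  by move=> g; exact: ler_norm_rgib.
move=> g g'; rewrite -[leRHS]mulrA -[X in _ * X]mulrA.
by apply: rgib_lip => // t; exact: tilt_lip.
Qed.

Lemma meanZ b n a Phi : bdd Phi -> mean b n (fun u => a * Phi u) = a * mean b n Phi.
Proof.
move=> bP; rewrite /mean -AvZ; [|exact: tame_rgib].
by congr Av; apply/funext => g; rewrite rgibZl.
Qed.

Lemma mean_sum (S : Type) (r : seq S) (P : pred S) b n (F : S -> (nat -> T) -> R) :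
  (forall s, bdd (F s)) ->
  mean b n (fun u => \sum_(s <- r | P s) F s u) = \sum_(s <- r | P s) mean b n (F s).
Proof.
move=> bF; rewrite /mean -Av_sum; [|by move=> s; exact: tame_rgib].
by congr Av; apply/funext => g; rewrite rgib_sum.
Qed.

Lemma mean_eq b n Phi Psi : Phi =1 Psi -> mean b n Phi = mean b n Psi.
Proof. by move=> /funext ->. Qed.

Lemma ler_norm_mean b n Phi (M : R) : (forall u, `|Phi u| <= M) -> `|mean b n Phi| <= M.
Proof.
move=> PM; rewrite -[leRHS](@Av_cst _ I); apply: ler_norm_Av.
- by apply: tame_rgib; exists M.
- exact: tame_cst.
- by move=> g; exact: ler_norm_rgib.
Qed.

Lemma mean_marg b n Phi : depends_below n Phi -> mean b n.+1 Phi = mean b n Phi.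
Proof. by move=> dP; congr Av; apply/funext => g; exact: rgib_marg. Qed.

Lemma dependsM n Phi Psi : depends_below n Phi -> depends_below n Psi ->
  depends_below n (fun u => Phi u * Psi u).
Proof. by move=> dP dQ u v uv; rewrite (dP u v)// (dQ u v). Qed.

Lemma depends_coord n (f : T -> R) k : (k < n)%N -> depends_below n (fun u => f (u k)).
Proof. by move=> kn u v uv; rewrite uv. Qed.

Lemma dependsS n Phi : depends_below n Phi -> depends_below n.+1 Phi.
Proof. by move=> dP u v uv; apply: dP => k kn; apply: uv; exact: ltnW. Qed.

(** Shifting [g i] by [h] adds [h * b * c i * sg i t] to the exponent, so [rgib_taylor] supplies the
    expansion that [avs_ibp] asks for, with a constant free of [g]. *)
Lemma ibp_coord b n Phi i : depends_below n Phi -> bdd Phi ->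
  Av (fun g => g i * rgib t0 n (tilt b g) Phi) =
  b * c i * (mean b n (fun u => Phi u * \sum_(l < n) sg i (u l))
             - n%:R * mean b n.+1 (fun u => Phi u * sg i (u n))).
Proof.
move=> dP bP; have [M PM] := bP.
have bs m (l : nat) : bdd (fun u => sg i (u l)) by exact: bdd_fin.
have b1 : bdd (fun u => Phi u * \sum_(l < n) sg i (u l)).
  by apply: bddM => //; apply: bdd_sum => l; exact: bdd_fin.
have b2 : bdd (fun u => Phi u * sg i (u n)) by apply: bddM => //; exact: bdd_fin.
have tr1 := tame_rgib b n b1; have tr2 := tame_rgib b n.+1 b2.
rewrite /mean -AvZ// -AvB//; last exact: tameZ.
rewrite -AvZ; last by under eq_fun do rewrite -mulN1r; apply: tameD => //; do 2 apply: tameZ.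
pose L := `|b * c i|.
apply: (@avs_ibp _ _ _ _ _ _ (6 * M * (n%:R * L) ^+ 2) M).
- exact: enum_uniq.
- by rewrite mem_enum.
- exact: tame_rgib.
- apply: tameZ; under eq_fun do rewrite -mulN1r.
  by apply: tameD => //; do 2 apply: tameZ.
- by move=> g; exact: ler_norm_rgib.
move=> g h; pose et t := b * c i * sg i t.
have -> : tilt b (upd g i (g i + h)) = (fun t => tilt b g t + h * et t).
  apply/funext => t; rewrite /tilt /field /et (bigD1 i)//= upd_same.
  rewrite [in RHS](bigD1 i)//= (eq_bigr (fun j => c j * g j * sg j t)); last first.
    by move=> j ji; rewrite /upd (negbTE ji).
  ring.
have -> : b * c i * (rgib t0 n (tilt b g) (fun u => Phi u * \sum_(l < n) sg i (u l)) -
     n%:R * rgib t0 n.+1 (tilt b g) (fun u => Phi u * sg i (u n))) =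
   rgib t0 n (tilt b g) (fun u => Phi u * \sum_(l < n) et (u l)) -
     n%:R * rgib t0 n.+1 (tilt b g) (fun u => Phi u * et (u n)).
  rewrite mulrBr -(rgibZl _ n _ (b * c i)) [X in _ - X]mulrCA -(rgibZl _ n.+1 _ (b * c i)).
  congr (_ - _ * _); apply: rgib_eq => u.
    by rewrite mulrCA mulr_sumr.
  by rewrite mulrCA.
apply: rgib_taylor => // t.
by rewrite /et normrM -[leRHS]mulr1 ler_pM.
Qed.

End model.

(** The exit from quantitative bounds: an averaged Taylor estimate becomes a genuine derivative. *)
Lemma is_derive_of_quadratic (R : realType) (f : R -> R) (x d A : R) :
  (forall u, `|f (x + u) - f x - u * d| <= A * u ^+ 2) -> is_derive x (1 : R) f d.
Proof.
move=> fA.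
have cv : (fun h : R => h^-1 *: (f (h *: 1 + x) - f x)) @ 0^' --> d.
  apply/cvgrPdist_le => e e0; near=> h.
  have h0 : h != 0 by near: h; exact: nbhs_dnbhs_neq.
  have hA : `|h| <= e / (`|A| + 1).
    by near: h; apply: dnbhs0_le; rewrite divr_gt0// ltr_wpDl.
  have := fA h.
  rewrite /GRing.scale/= mulr1 (addrC h) => fh.
  have -> : d - h^-1 * (f (x + h) - f x) = - (h^-1 * (f (x + h) - f x - h * d)).
    by field.
  rewrite normrN normrM normfV mulrC ler_pdivrMr ?normr_gt0//.
  rewrite (le_trans fh)// -(real_normK (num_real h)) expr2 mulrA ler_wpM2r//.
  have : `|h| * (`|A| + 1) <= e by rewrite -ler_pdivlMr// ltr_wpDl.
  have := ler_norm A; have := normr_ge0 h; nra.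
split; first by apply/cvg_ex; exists d.
exact: cvg_lim.
Unshelve. all: end_near. Qed.

Lemma continuous_of_lip (R : realType) (f : R -> R) (A : R) :
  (forall x u, `|f (x + u) - f x| <= A * `|u|) -> continuous f.
Proof.
move=> fA; apply: (@continuous_of_loclip _ _ `|A| 0) => // x y.
rewrite mul0r expR0 mulr1; have := fA y (x - y).
rewrite addrCA subrr addr0 => /le_trans; apply.
by rewrite ler_wpM2r// ler_norm.
Qed.

(** * Integration by parts with the covariance, and the temperature derivative *)

Section identities.
Context {R : realType} {T I : finType} (t0 : T) (c : I -> R) (sg : I -> T -> R).
Hypothesis sg1 : forall i t, `|sg i t| <= 1.
Context (N c0 : R).
Hypothesis N_gt0 : 0 < N.

Definition ncov t t' : R := N^-1 * \sum_i c i ^+ 2 * sg i t * sg i t'.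

Hypothesis ncov_diag : forall t, ncov t t = c0.

Implicit Types (g : I -> R) (Phi Psi : (nat -> T) -> R) (n : nat) (b : R).
Notation field := (field c sg).
Notation tilt := (tilt c sg).
Notation mean := (mean t0 c sg).
Notation field_bound := (field_bound c).

Lemma ncovC t t' : ncov t t' = ncov t' t.
Proof. by congr (_ * _); apply: eq_bigr => i _; rewrite mulrAC. Qed.

(** The observable on the left depends on the disorder; expanding the field isolates the factors
    [g i] to which [ibp_coord] applies. *)
Lemma rgib_field n th g Phi k :
  rgib t0 n th (fun u => Phi u * field g (u k)) =
  \sum_i c i * (g i * rgib t0 n th (fun u => Phi u * sg i (u k))).
Proof.
rewrite (eq_bigr (fun i => rgib t0 n th (fun u => c i * g i * (Phi u * sg i (u k))))).
  rewrite -rgib_sum; apply: rgib_eq => u; rewrite /field mulr_sumr.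
  by apply: eq_bigr => i _; ring.
by move=> i _; rewrite rgibZl mulrA.
Qed.

Lemma tame_rgib_field b n Phi k : bdd Phi ->
  tame (fun g => rgib t0 n (tilt b g) (fun u => Phi u * field g (u k))).
Proof.
move=> bP; under eq_fun do rewrite rgib_field.
apply: tame_sum => i; apply: tameZ; apply: tameM; first exact: tame_coord.
by apply: tame_rgib => //; apply: bddM => //; exact: bdd_fin.
Qed.

(** One factor [c i] comes from the field and one from [ibp_coord]; summed over [i], the terms
    [c i ^+ 2 * sg i * sg i] rebuild [N] times the covariance. *)
Lemma ibp_field b n Phi k : depends_below n Phi -> bdd Phi -> (k < n)%N ->
  Av (fun g => rgib t0 n (tilt b g) (fun u => Phi u * field g (u k))) =
  b * N * (\sum_(l < n) mean b n (fun u => Phi u * ncov (u k) (u l))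
           - n%:R * mean b n.+1 (fun u => Phi u * ncov (u k) (u n))).
Proof.
move=> dP bP kn.
under eq_fun do rewrite rgib_field.
have bPs i : bdd (fun u => Phi u * sg i (u k)) by apply: bddM => //; exact: bdd_fin.
have dPs i : depends_below n (fun u => Phi u * sg i (u k)).
  by apply: dependsM => //; exact: depends_coord.
rewrite Av_sum; last first.
  move=> i; apply: tameZ; apply: tameM; first exact: tame_coord.
  exact: tame_rgib.
have bPss i l : bdd (fun u => Phi u * sg i (u k) * sg i (u l)).
  by apply: bddM => //; exact: bdd_fin.
have covE m l : mean b m (fun u => Phi u * ncov (u k) (u l)) =
    N^-1 * \sum_i c i ^+ 2 * mean b m (fun u => Phi u * sg i (u k) * sg i (u l)).
  rewrite (eq_bigr (fun i => mean b m (fun u => c i ^+ 2 * (Phi u * sg i (u k) * sg i (u l))))).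
    rewrite -mean_sum//; last by move=> i; have [M PM] := bPss i l;
      exists (`|c i ^+ 2| * M) => u; rewrite normrM ler_wpM2l.
    rewrite -meanZ//; last by apply: bdd_sum => // i; have [M PM] := bPss i l;
      exists (`|c i ^+ 2| * M) => u; rewrite normrM ler_wpM2l.
    apply: mean_eq => u; rewrite /ncov mulrCA mulr_sumr; congr (_ * _).
    by apply: eq_bigr => i _; ring.
  by move=> i _; rewrite meanZ.
rewrite (eq_bigr (fun l : 'I_n => N^-1 * \sum_i c i ^+ 2 *
   mean b n (fun u => Phi u * sg i (u k) * sg i (u l)))); last by move=> l _; rewrite covE.
rewrite covE -mulr_sumr exchange_big/=.
have cancelN (x y : R) : b * N * (N^-1 * x - n%:R * (N^-1 * y)) = b * (x - n%:R * y).
  by field; rewrite gt_eqF.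
rewrite cancelN [n%:R * _]mulr_sumr -sumrB mulr_sumr; apply: eq_bigr => i _.
rewrite AvZ; last by apply: tameM; [exact: tame_coord|exact: tame_rgib].
rewrite ibp_coord//.
have -> : mean b n (fun u => Phi u * sg i (u k) * \sum_(l < n) sg i (u l)) =
    \sum_(l < n) mean b n (fun u => Phi u * sg i (u k) * sg i (u l)).
  by rewrite -mean_sum//; apply: mean_eq => u; rewrite mulr_sumr.
by rewrite -mulr_sumr; ring.
Qed.

Lemma mean_cov_diag b n Phi k : bdd Phi ->
  mean b n (fun u => Phi u * ncov (u k) (u k)) = c0 * mean b n Phi.
Proof. by move=> bP; rewrite -meanZ//; apply: mean_eq => u; rewrite ncov_diag mulrC. Qed.

(** Abstract counterpart of [integrand1]; the replica numbers r, r + 1, r + 2 are the values of the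
    maximum taken in [qavGq]. *)
Definition stab_integrand r Phi b : R :=
  \sum_(k < r) \sum_(l < r | k != l) mean b r (fun u => Phi u * ncov (u l) (u k))
  - (2 * r)%:R * \sum_(l < r) mean b r.+1 (fun u => Phi u * ncov (u l) (u r))
  + (r * r.+1)%:R * mean b r.+2 (fun u => Phi u * ncov (u r) (u r.+1)).

(** The expansion holds for each fixed disorder by [rgib_taylor] and is then averaged; its remainder
    involves [field_bound] squared, whose mean is finite and independent of [b]. *)
Lemma mean_taylor n Phi : depends_below n Phi -> bdd Phi ->
  exists A : R, forall b u, `|mean (b + u) n Phi - mean b n Phi
    - u * (b * N * stab_integrand n Phi b)| <= A * u ^+ 2.
Proof.
move=> dP bP; have [M PM] := bP.
pose Q g := (n%:R * field_bound g) * (n%:R * field_bound g).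
have tQ : tame Q by apply: tameM; apply/tameZ/tame_field_bound.
exists (6 * M * Av Q) => b u.
pose D g := \sum_(k < n) rgib t0 n (tilt b g) (fun v => Phi v * field g (v k))
  - n%:R * rgib t0 n.+1 (tilt b g) (fun v => Phi v * field g (v n)).
have tD1 : tame (fun g => \sum_(k < n) rgib t0 n (tilt b g) (fun v => Phi v * field g (v k))).
  by apply: tame_sum => k; exact: tame_rgib_field.
have tD2 : tame (fun g => n%:R * rgib t0 n.+1 (tilt b g) (fun v => Phi v * field g (v n))).
  by apply: tameZ; exact: tame_rgib_field.
have tB F G : tame F -> tame G -> tame (fun g : I -> R => F g - G g).
  by move=> tF tG; under eq_fun do rewrite -mulN1r; apply: tameD => //; exact: tameZ.
have tD : tame D by exact: tB.
have -> : b * N * stab_integrand n Phi b = Av D.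
  rewrite /D AvB// Av_sum; last by move=> k; exact: tame_rgib_field.
  rewrite AvZ; last exact: tame_rgib_field.
  have sE : \sum_(l < n) mean b n.+1 (fun u => Phi u * ncov (u n) (u l)) =
      \sum_(l < n) mean b n.+1 (fun u => Phi u * ncov (u l) (u n)).
    by apply: eq_bigr => l _; apply: mean_eq => v; rewrite ncovC.
  (* Both families produce [n] times the sum of the covariances with replica [n], which makes the
     factor [2 * n]; the diagonal contributions [n * c0 * mean b n Phi] cancel. *)
  rewrite (ibp_field _ (dependsS dP))// (eq_bigr _ (fun k _ => ibp_field _ dP bP (ltn_ord k))).
  rewrite -mulr_sumr mulrCA -mulrBr; congr (_ * _).
  rewrite big_ord_recr/= mean_cov_diag// mean_marg// sumrB -mulr_sumr.
  rewrite (eq_bigr (fun k : 'I_n => \sum_(l < n | k != l)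
     mean b n (fun u => Phi u * ncov (u l) (u k)) + c0 * mean b n Phi)); last first.
    move=> k _; rewrite (bigD1 k)//= mean_cov_diag// addrC; congr (_ + _).
    apply: eq_big => [l|l _]; first by rewrite eq_sym.
    by apply: mean_eq => v; rewrite ncovC.
  rewrite big_split/= sumr_const card_ord /stab_integrand.
  rewrite sE; set S := \sum_(l < n) mean b n.+1 _.
  by rewrite !natrM -[n.+1%:R]natr1 -mulr_natl; ring.
have -> : mean (b + u) n Phi - mean b n Phi - u * Av D =
    Av (fun g => rgib t0 n (tilt (b + u) g) Phi - rgib t0 n (tilt b g) Phi - u * D g).
  have t1 := tame_rgib t0 c sg1 (b + u) n bP.
  have t2 := tame_rgib t0 c sg1 b n bP.
  by rewrite (AvB (tB _ _ t1 t2) (tameZ u tD)) (AvB t1 t2) AvZ.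
have -> : 6 * M * Av Q * u ^+ 2 = Av (fun g => (6 * M * u ^+ 2) * Q g).
  by rewrite AvZ//; ring.
apply: ler_norm_Av.
- apply: (tB _ _ _ (tameZ u tD)).
  by apply: tB; exact: tame_rgib.
- exact: tameZ.
move=> g.
have -> : tilt (b + u) g = (fun t => tilt b g t + u * field g t).
  by apply/funext => t; rewrite /tilt mulrDl.
have -> : D g = rgib t0 n (tilt b g) (fun v => Phi v * \sum_(i < n) field g (v i))
   - n%:R * rgib t0 n.+1 (tilt b g) (fun v => Phi v * field g (v n)).
  rewrite /D -rgib_sum; congr (_ - _); apply: rgib_eq => v.
  by rewrite mulr_sumr.
rewrite /Q mulrAC -expr2; apply: rgib_taylor => // t.
exact: ler_field.
Qed.

End identities.

(** * Fluctuations of the pressure *)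

Lemma rgib_lip_tilt (R : realType) (T I : finType) (t0 : T) (c : I -> R)
    (sg : I -> T -> R) (sg1 : forall i t, `|sg i t| <= 1) n Phi (M : R) b u g :
  (forall v, `|Phi v| <= M) ->
  `|rgib t0 n (tilt c sg (b + u) g) Phi - rgib t0 n (tilt c sg b g) Phi| <=
  2 * M * (n%:R * (`|u| * field_bound c g)).
Proof.
move=> PM; apply: rgib_lip => // t.
have -> : tilt c sg (b + u) g t - tilt c sg b g t = u * field c sg g t.
  by rewrite /tilt; ring.
by rewrite normrM ler_wpM2l// ler_field.
Qed.

Section pressure.
Context {R : realType} {T I : finType} (t0 : T) (c : I -> R) (sg : I -> T -> R).
Hypothesis sg1 : forall i t, `|sg i t| <= 1.
Context (N c0 cbar : R).
Hypothesis N_gt0 : 0 < N.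
Hypothesis ncov_diag : forall t, ncov c sg N t t = c0.
Hypothesis stable : N^-1 * \sum_i c i ^+ 2 <= cbar.

Implicit Types (g : I -> R) (Phi Psi : (nat -> T) -> R) (n : nat) (b : R).
Notation field := (field c sg).
Notation tilt := (tilt c sg).
Notation mean := (mean t0 c sg).
Notation field_bound := (field_bound c).
Notation ncov := (ncov c sg N).

Definition pressure b g : R := N^-1 * ln (gibZ (tilt b g)).
Definition dpressure b g : R := N^-1 * gib (tilt b g) (field g).
Definition mpressure b : R := Av (pressure b).
Definition mdpressure b : R := Av (dpressure b).
Definition overlap b : R := mean b 2 (fun u => ncov (u 0) (u 1)).
(** The variance of a standard Gaussian, kept as an unevaluated constant. *)
Definition gauss_var : R := gauss_mean (fun x : R => x ^+ 2).

Let Ninv_ge0 : 0 <= N^-1. Proof. by rewrite invr_ge0 ltW. Qed.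

(** Gives continuity in [b], hence integrability of both integrands over the temperature. *)
Lemma mean_lip n Phi : bdd Phi -> exists A : R,
  forall b u, `|mean (b + u) n Phi - mean b n Phi| <= A * `|u|.
Proof.
move=> [M PM]; exists (2 * M * (n%:R * Av field_bound)) => b u.
have bP : bdd Phi by exists M.
have tF := tame_field_bound c.
rewrite /mean -AvB; [|exact: tame_rgib..].
have -> : 2 * M * (n%:R * Av field_bound) * `|u| =
    Av (fun g => (2 * M * n%:R * `|u|) * field_bound g).
  by rewrite AvZ//; ring.
apply: ler_norm_Av.
- by under eq_fun do rewrite -mulN1r; apply: tameD; [|apply: tameZ]; exact: tame_rgib.
- exact: tameZ.
- move=> g; rewrite (le_trans (rgib_lip_tilt _ _ sg1 n b u g PM))//.
  by rewrite le_eqVlt; apply/orP; left; apply/eqP; ring.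
Qed.

Lemma continuous_mean n Phi : bdd Phi -> continuous (fun b => mean b n Phi).
Proof. by move=> /(mean_lip n)[A] /continuous_of_lip. Qed.

Lemma ler_norm_ncov t t' : `|ncov t t'| <= cbar.
Proof.
rewrite (le_trans _ stable)// /(ncov t t') normrM ger0_norm//.
rewrite ler_wpM2l// (le_trans (ler_norm_sum _ _ _))// ler_sum// => i _.
rewrite -mulrA normrM ger0_norm ?sqr_ge0// -[leRHS]mulr1.
by rewrite ler_wpM2l ?sqr_ge0// normrM -[leRHS]mulr1 ler_pM.
Qed.

Lemma pressure_ge b b' g : pressure b g + (b' - b) * dpressure b g <= pressure b' g.
Proof.
have := ln_gibZ_ge t0 (tilt b g) (fun t => (b' - b) * field g t).
have -> : (fun t => tilt b g t + (b' - b) * field g t) = tilt b' g.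
  by apply/funext => t; rewrite /tilt; ring.
rewrite gibZl /pressure /dpressure => h.
by rewrite mulrCA -mulrDr ler_wpM2l.
Qed.

(** The pressure is Lipschitz but unbounded in [g]; its growth is controlled by its value at [g = 0]
    plus the Lipschitz term. *)
Lemma tame_pressure b : tame (pressure b).
Proof.
pose K := `|b| * (\sum_i `|c i|).
have K0 : 0 <= K by rewrite mulr_ge0// sumr_ge0.
have lip g g' : `|ln (gibZ (tilt b g)) - ln (gibZ (tilt b g'))| <=
    K * l1 (fun i => g i - g' i).
  by apply: (ln_gibZ_lip t0) => t; exact: tilt_lip.
apply: tameZ; exists (`|ln (gibZ (tilt b (fun=> 0)))| + K), 1; split => //.
- by rewrite addr_ge0.
- move=> g; have := lip g (fun=> 0).
  have -> : (fun i => g i - 0) = g by apply/funext => i; rewrite subr0.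
  set z := ln _; set z0 := ln _; move=> h.
  have e1 : 1 <= expR (1 * l1 g) by rewrite -[leLHS]expR0 ler_expR mul1r l1_ge0.
  have e2 : l1 g <= expR (1 * l1 g).
    by rewrite mul1r (le_trans _ (expR_ge1Dx _))// lerDr.
  have -> : z = z0 + (z - z0) by ring.
  rewrite (le_trans (ler_normD _ _))// mulrDl lerD//.
    by rewrite ler_peMr.
  by rewrite (le_trans h)// ler_wpM2l.
- move=> g g'; rewrite (le_trans (lip g g'))// ler_wpM2r ?l1_ge0//.
  rewrite mul1r -[leLHS]mulr1 ler_pM//; first by rewrite lerDr.
  by rewrite -expR0 ler_expR addr_ge0 ?l1_ge0.
Qed.

(** The squares of these constants sum to [b^2 / N^2] times the sum of [c i ^+ 2], which stability
    bounds by [b^2 cbar / N]. *)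
Lemma pressure_coord_lip b :
  coord_lip (fun i => N^-1 * (`|b| * `|c i|)) (pressure b).
Proof.
move=> g i x; rewrite /pressure -mulrBr normrM ger0_norm// -mulrA ler_wpM2l//.
apply: (ln_gibZ_lip t0) => t.
have -> : tilt b (upd g i x) t - tilt b g t = b * (c i * (x - g i) * sg i t).
  rewrite /tilt -mulrBr fieldB; congr (_ * _).
  rewrite /field (bigD1 i)//= upd_same big1 ?addr0// => j ji.
  by rewrite /upd (negbTE ji) subrr mulr0 mul0r.
by rewrite !normrM -[leRHS]mulrA ler_wpM2l// -[leRHS]mulr1 ler_pM// mulr_ge0.
Qed.

Lemma gauss_var_ge0 : 0 <= gauss_var.
Proof.
by apply: Rintegral_ge0 => x _; rewrite mulr_ge0 ?normal_pdf_ge0// sqr_ge0.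
Qed.

Lemma tame_pressureB b : tame (fun g => pressure b g - mpressure b).
Proof. by apply: tameD; [exact: tame_pressure|exact: tame_cst]. Qed.

Lemma variance_pressure b :
  Av (fun g => (pressure b g - mpressure b) ^+ 2) <=
  gauss_var * b ^+ 2 * cbar / N.
Proof.
have tp := tame_pressure b.
have tp2 : tame (fun g => pressure b g ^+ 2).
  by under eq_fun do rewrite expr2; exact: tameM.
have -> : (fun g => (pressure b g - mpressure b) ^+ 2) =
  (fun g => pressure b g ^+ 2 + ((- 2 * mpressure b) * pressure b g + mpressure b ^+ 2)).
  by apply/funext => g; ring.
have tl : tame (fun g => (- 2 * mpressure b) * pressure b g) by exact: tameZ.
have tc := tame_cst (I := I) (mpressure b ^+ 2).
rewrite (AvD tp2 (tameD tl tc)) (AvD tl tc) (AvZ _ tp) Av_cst -/(mpressure b).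
have := avs_variance (enum I) (fun=> 0) tp (pressure_coord_lip b).
rewrite -/gauss_var -/(Av (pressure b)) -/(mpressure b) -/(Av (fun g => pressure b g ^+ 2)).
have -> : Av (fun g => pressure b g ^+ 2) + (-2 * mpressure b * mpressure b
  + mpressure b ^+ 2) = Av (fun g => pressure b g ^+ 2) - mpressure b ^+ 2 by ring.
move=> /le_trans; apply; rewrite big_enum/=.
have -> : gauss_var * b ^+ 2 * cbar / N = gauss_var * (b ^+ 2 * (cbar / N)) by ring.
rewrite ler_wpM2l ?gauss_var_ge0//.
have -> : \sum_i (N^-1 * (`|b| * `|c i|)) ^+ 2 =
    b ^+ 2 * (N^-1 * \sum_i c i ^+ 2) / N.
  rewrite [X in _ * X / _]mulr_sumr mulr_sumr mulr_suml; apply: eq_bigr => i _.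
  by rewrite !exprMn !real_normK ?num_real//; ring.
by rewrite -[leLHS]mulrA ler_wpM2l ?sqr_ge0// ler_wpM2r.
Qed.

(** Bounds a mean absolute value by [(variance / la + la) / 2]; the free parameter [la] replaces the
    square root of the variance. *)
Definition fluct_bound b (la : R) : R :=
  (gauss_var * b ^+ 2 * cbar / N / la + la) / 2.

Lemma fluct_pressure b (la : R) : 0 < la ->
  Av (fun g => `|pressure b g - mpressure b|) <= fluct_bound b la.
Proof.
rewrite /fluct_bound => la0; have tp := tame_pressureB b.
have tp2 : tame (fun g => (pressure b g - mpressure b) ^+ 2).
  by under eq_fun do rewrite expr2; exact: tameM.
have tc := tame_cst (I := I) (la / 2).
apply: (@le_trans _ _ (Av (fun g => (la^-1 / 2) * (pressure b g - mpressure b) ^+ 2 + la / 2))).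
  apply: Av_le; [exact: tame_norm|by apply: tameD => //; exact: tameZ|move=> g].
  rewrite -(real_normK (num_real (_ - _))); set y := `|_|.
  rewrite -subr_ge0.
  have -> : la^-1 / 2 * y ^+ 2 + la / 2 - y = (y - la) ^+ 2 / (2 * la).
    by field; rewrite gt_eqF.
  by rewrite mulr_ge0 ?sqr_ge0// invr_ge0 mulr_ge0// ltW.
rewrite (AvD (tameZ (la^-1 / 2) tp2) tc) (AvZ _ tp2) Av_cst mulrDl lerD2r.
rewrite [leLHS]mulrAC ler_wpM2r// [leRHS]mulrC; apply: ler_wpM2l.
  by rewrite invr_ge0 ltW.
exact: variance_pressure.
Qed.

(** The factor 1 is the constant observable to which [ibp_field] is applied next. *)
Lemma dpressureE b : dpressure b =
  fun g => N^-1 * rgib t0 1 (tilt b g) (fun u => 1 * field g (u 0)).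
Proof.
apply/funext => g.
by rewrite /dpressure; under rgib_eq do rewrite mul1r; rewrite rgib1.
Qed.

Lemma bdd_cst (a : R) : bdd (fun _ : nat -> T => a).
Proof. by exists `|a|. Qed.

Lemma tame_dpressure b : tame (dpressure b).
Proof.
rewrite dpressureE; apply: tameZ; apply: tame_rgib_field => //.
exact: bdd_cst.
Qed.

(** Integration by parts with one replica; this is where the mean overlap of two replicas in the
    second identity comes from. *)
Lemma mdpressureE b : mdpressure b = b * (c0 - overlap b).
Proof.
rewrite /mdpressure dpressureE.
rewrite AvZ; last by apply: tame_rgib_field => //; exact: bdd_cst.
rewrite (ibp_field _ _ sg1 N_gt0)//; last exact: bdd_cst.
rewrite big_ord1 mul1r (mean_cov_diag _ sg1 ncov_diag)//; last exact: bdd_cst.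
have -> : mean b 1 (fun=> 1) = 1.
  rewrite -[RHS](@Av_cst _ I); congr Av; apply/funext => g.
  exact: (gib_cst [ffun=> t0]).
have -> : mean b 2 (fun u => 1 * ncov (u 0) (u 1)) = overlap b.
  by apply: mean_eq => u; rewrite mul1r.
by field; rewrite gt_eqF.
Qed.

Lemma mpressure_ge b b' : mpressure b + (b' - b) * mdpressure b <= mpressure b'.
Proof.
have td := tame_dpressure b.
rewrite -AvZ// -AvD; [|exact: tame_pressure|exact: tameZ].
apply: Av_le.
- by apply: tameD; [exact: tame_pressure|exact: tameZ].
- exact: tame_pressure.
- by move=> g; exact: pressure_ge.
Qed.

Lemma mdpressure_lip : exists A : R,
  forall b u, `|mdpressure (b + u) - mdpressure b| <= A * `|u|.
Proof.
have tQ : tame (fun g => field_bound g * field_bound g).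
  by apply: tameM; exact: tame_field_bound.
exists (N^-1 * 2 * Av (fun g => field_bound g * field_bound g)) => b u.
rewrite /mdpressure -AvB; [|exact: tame_dpressure..].
rewrite mulrAC -AvZ//; apply: ler_norm_Av.
- under eq_fun do rewrite -mulN1r.
  by apply: tameD; [|apply: tameZ]; exact: tame_dpressure.
- exact: tameZ.
move=> g; rewrite /dpressure -mulrBr normrM ger0_norm// -!mulrA ler_wpM2l//.
have := @gib_lip _ _ t0 (tilt b g) (tilt (b + u) g) (field g) (field_bound g)
   (`|u| * field_bound g) (ler_field _ sg1 g).
move=> /(_ _)/le_trans; apply.
  move=> t; have -> : tilt (b + u) g t - tilt b g t = u * field g t.
    by rewrite /tilt; ring.
  by rewrite normrM ler_wpM2l// ler_field.
by rewrite le_eqVlt; apply/orP; left; apply/eqP; ring.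
Qed.

(** Convexity traps the increment of [mpressure] between [u * mdpressure b] and
    [u * mdpressure (b + u)], and these differ by O(u^2) because [mdpressure] is Lipschitz. *)
Lemma is_derive_mpressure b : is_derive b (1 : R) mpressure (mdpressure b).
Proof.
have [A lipA] := mdpressure_lip.
apply: (@is_derive_of_quadratic _ _ _ _ A) => u.
have h1 := mpressure_ge b (b + u); have h2 := mpressure_ge (b + u) b.
have e1 : b + u - b = u by ring.
have e2 : b - (b + u) = - u by ring.
rewrite e1 in h1; rewrite e2 in h2.
rewrite ger0_norm; last by lra.
apply: (@le_trans _ _ (u * (mdpressure (b + u) - mdpressure b))); first by lra.
rewrite (le_trans (ler_norm _))// normrM -(real_normK (num_real u)) expr2.
by rewrite mulrC mulrA ler_wpM2r.
Qed.

Lemma continuous_mdpressure : continuous mdpressure.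
Proof. by have [A] := mdpressure_lip; exact: continuous_of_lip. Qed.

Lemma cbar_ge0 : 0 <= cbar.
Proof. by rewrite (le_trans _ (ler_norm_ncov t0 t0)). Qed.

Lemma ler_norm_mdpressure b : `|mdpressure b| <= `|b| * (cbar + cbar).
Proof.
rewrite mdpressureE normrM ler_wpM2l// (le_trans (ler_normB _ _))// lerD//.
  by rewrite -(ncov_diag t0) ler_norm_ncov.
by apply: ler_norm_mean => // u; exact: ler_norm_ncov.
Qed.

Definition gg_integrand r Phi b : R :=
  \sum_(k < r) mean b r.+1 (fun u => Phi u * ncov (u k) (u r))
  - r.+1%:R * mean b r.+2 (fun u => Phi u * ncov (u r) (u r.+1))
  + mean b r Phi * overlap b.

(** A fresh replica [r] carries the field, so [ibp_field] is used with r + 1 replicas. Its diagonal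
    term [c0] cancels the [c0] of [mdpressureE], which leaves the product with [overlap]. *)
Lemma gg_integrandE r Phi b : depends_below r Phi -> bdd Phi ->
  b * gg_integrand r Phi b =
  Av (fun g => rgib t0 r (tilt b g) Phi * (dpressure b g - mdpressure b)).
Proof.
move=> dP bP.
have tr := tame_rgib t0 c sg1 b r bP; have td := tame_dpressure b.
have -> : (fun g => rgib t0 r (tilt b g) Phi * (dpressure b g - mdpressure b)) =
   (fun g => N^-1 * rgib t0 r.+1 (tilt b g) (fun u => Phi u * field g (u r))
      - mdpressure b * rgib t0 r (tilt b g) Phi).
  by apply/funext => g; rewrite rgib_indep// /dpressure; ring.
have tf : tame (fun g => rgib t0 r.+1 (tilt b g) (fun u => Phi u * field g (u r))).
  exact: tame_rgib_field.
rewrite (AvB (tameZ _ tf) (tameZ _ tr)) !AvZ// -/(mean b r Phi).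
rewrite (ibp_field _ _ sg1 N_gt0 _ (dependsS dP))// mdpressureE.
rewrite big_ord_recr/= (mean_cov_diag _ sg1 ncov_diag)// mean_marg//.
have -> : \sum_(l < r) mean b r.+1 (fun u => Phi u * ncov (u r) (u l)) =
   \sum_(l < r) mean b r.+1 (fun u => Phi u * ncov (u l) (u r)).
  by apply: eq_bigr => l _; apply: mean_eq => v; rewrite ncovC.
by rewrite /gg_integrand; field; rewrite gt_eqF.
Qed.

(* [pressure] is convex in [b], so difference quotients with step [de]
   sandwich [dpressure]. *)
Lemma gg_integrand_bound r Phi b (de la : R) : depends_below r Phi ->
  (forall u, `|Phi u| <= 1) -> 0 < de -> 0 < la ->
  `|b * gg_integrand r Phi b| <=
  de^-1 * (fluct_bound (b + de) la + fluct_bound b la + fluct_bound (b - de) la)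
  + (mdpressure (b + de) - mdpressure (b - de)).
Proof.
move=> dP P1 de0 la0.
rewrite gg_integrandE//; last by exists 1.
pose E x g := `|pressure x g - mpressure x|.
have tE x : tame (E x) by apply: tame_norm; exact: tame_pressureB.
set Y := mdpressure (b + de) - _.
have tEE : tame (fun g => E (b + de) g + E b g) by exact: tameD.
have tEEE : tame (fun g => E (b + de) g + E b g + E (b - de) g) by exact: tameD.
have tc := tame_cst (I := I) Y.
apply: (@le_trans _ _ (Av (fun g => de^-1 * (E (b + de) g + E b g + E (b - de) g) + Y))).
  apply: ler_norm_Av.
  - apply: tameM; first by apply: tame_rgib => //; exists 1.
    by apply: tameD; [exact: tame_dpressure|exact: tame_cst].
  - by apply: tameD => //; exact: tameZ.
  move=> g; rewrite normrM -[leRHS]mul1r; apply: ler_pM => //.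
    exact: ler_norm_rgib.
  set x := dpressure b g - _.
  (* [h1] and [h2] bound the random derivative by difference quotients, [h3] and [h4] bound the
     averaged quotients by [mdpressure] at [b + de] and [b - de]. With [h5] and [h6] they also show
     that [mdpressure b] lies between these two values. *)
  have h1 := pressure_ge b (b + de) g; have h2 := pressure_ge b (b - de) g.
  have h3 := mpressure_ge (b + de) b; have h4 := mpressure_ge (b - de) b.
  have h5 := mpressure_ge b (b + de); have h6 := mpressure_ge b (b - de).
  have e1 : b + de - b = de by ring.
  have e2 : b - de - b = - de by ring.
  have e3 : b - (b + de) = - de by ring.
  have e4 : b - (b - de) = de by ring.
  rewrite e1 in h1 h5; rewrite e2 in h2 h6; rewrite e3 in h3; rewrite e4 in h4.
  rewrite -(ler_pM2l de0) mulrDr mulVKf ?gt_eqF//.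
  rewrite -[de in leLHS](gtr0_norm de0) -normrM ler_norml /x /Y /E.
  have := ler_norm (pressure (b + de) g - mpressure (b + de)).
  have := lerNnormlW (lexx `|pressure (b + de) g - mpressure (b + de)|).
  have := ler_norm (pressure b g - mpressure b).
  have := lerNnormlW (lexx `|pressure b g - mpressure b|).
  have := ler_norm (pressure (b - de) g - mpressure (b - de)).
  have := lerNnormlW (lexx `|pressure (b - de) g - mpressure (b - de)|).
  move: `|_| `|_| `|_| => ? ? ? *.
  by apply/andP; split; lra.
rewrite (AvD (tameZ de^-1 tEEE) tc) (AvZ _ tEEE) Av_cst (AvD tEE (tE _)).
rewrite (AvD (tE _) (tE _)) lerD2r; apply: ler_wpM2l.
  by rewrite invr_ge0 ltW.
by apply: lerD; [apply: lerD|]; exact: fluct_pressure.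
Qed.

End pressure.

(** * Integration over the temperature *)

Section ftc.
Context {R : realType}.
Notation mu := (@lebesgue_measure R).

(** The conditions range over all [x >= a], so two-sided derivatives exist at both end points;
    functions of [Num.sqrt t] satisfy them as soon as [a > 0]. *)
Lemma integral_derive (U dU : R -> R) (a b : R) : a < b ->
  (forall x, a <= x -> is_derive x (1 : R) U (dU x)) ->
  (forall x, a <= x -> {for x, continuous dU}) ->
  \int[mu]_(x in `[a, b]) dU x = U b - U a.
Proof.
move=> ab UdU cdU; rewrite /Rintegral.
have cU x : a <= x -> {for x, continuous U}.
  move=> ax; apply/differentiable_continuous/derivable1_diffP.
  by have ? := UdU x ax; exact: ex_derive.
rewrite (@continuous_FTC2 _ dU U)//.
- apply: continuous_in_subspaceT => x.
  by rewrite inE/= in_itv/= => /andP[ax _]; exact: cdU.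
- split.
  + move=> x; rewrite in_itv/= => /andP[/ltW ax _].
    by have ? := UdU x ax; exact: ex_derive.
  + by apply: cvg_at_right_filter; exact: cU.
  + by apply: cvg_at_left_filter; apply: cU; exact: ltW.
- move=> x; rewrite in_itv/= => /andP[/ltW ax _].
  by rewrite derive1E; have := UdU x ax => ?; rewrite derive_val.
Qed.

Lemma integrable_continuous_itv (f : R -> R) (a b : R) :
  (forall x, a <= x -> {for x, continuous f}) ->
  mu.-integrable `[a, b] (EFin \o f).
Proof.
move=> cf; apply: continuous_compact_integrable; first exact: segment_compact.
apply: continuous_in_subspaceT => x.
by rewrite inE/= in_itv/= => /andP[ax _]; exact: cf.
Qed.

(** A majorant with a known primitive bounds the integral of [f] by the increment of that
    primitive. *)
Lemma integral_derive_bound (f U dU : R -> R) (a b : R) : a < b ->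
  (forall x, a <= x -> is_derive x (1 : R) U (dU x)) ->
  (forall x, a <= x -> {for x, continuous dU}) ->
  (forall x, a <= x -> {for x, continuous f}) ->
  (forall x, a <= x -> x <= b -> `|f x| <= dU x) ->
  `|\int[mu]_(x in `[a, b]) f x| <= U b - U a.
Proof.
move=> ab UdU cdU cf fdU.
rewrite -(integral_derive ab UdU cdU).
have intf := integrable_continuous_itv b cf.
apply: (le_trans (le_normr_Rintegral _ intf)) => //.
apply: le_Rintegral => //.
- exact: integrable_norm intf.
- exact: integrable_continuous_itv.
- by move=> x /=; rewrite in_itv/= => /andP[]; exact: fdU.
Qed.

End ftc.

(** * Finite-volume bounds on the two integrals *)

Section limits.
Context {R : realType} {T I : finType} (t0 : T) (c : I -> R) (sg : I -> T -> R).
Hypothesis sg1 : forall i t, `|sg i t| <= 1.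
Context (N c0 cbar : R).
Hypothesis N_gt0 : 0 < N.
Hypothesis ncov_diag : forall t, ncov c sg N t t = c0.
Hypothesis stable : N^-1 * \sum_i c i ^+ 2 <= cbar.
Context (b1 b2 : R).
Hypotheses (b1_gt0 : 0 < b1) (b12 : b1 < b2).
Implicit Types (Phi : (nat -> T) -> R).
Notation mean := (mean t0 c sg).
Notation ncov := (ncov c sg N).
Notation mu := (@lebesgue_measure R).

Let sq12 : b1 ^+ 2 < b2 ^+ 2.
Proof. by rewrite ltrXn2r// ?nnegrE ltW// (lt_trans b1_gt0). Qed.

Let sq_gt0 x : b1 ^+ 2 <= x -> 0 < x.
Proof. by apply: lt_le_trans; rewrite exprn_gt0. Qed.

Lemma bdd_cov Phi k l : bdd Phi -> bdd (fun u => Phi u * ncov (u k) (u l)).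
Proof. by move=> bP; apply: bddM => //; exact: bdd_fin2. Qed.

Lemma continuous_sumR (S : Type) (r : seq S) (P : pred S) (F : S -> R -> R) :
  (forall s, continuous (F s)) -> continuous (fun x => \sum_(s <- r | P s) F s x).
Proof.
move=> cF; elim: r => [|s r IH].
  by under eq_fun do rewrite big_nil; move=> x; exact: cvg_cst.
under eq_fun do rewrite big_cons; case: (P s) => // x.
by apply: cvgD; [exact: cF|exact: IH].
Qed.

Lemma continuous_scaleR (a : R) (f : R -> R) : continuous f -> continuous (fun x => a * f x).
Proof. by move=> cf x; apply: cvgM; [exact: cvg_cst|exact: cf]. Qed.

Lemma continuous_stab_integrand r Phi : bdd Phi ->
  continuous (stab_integrand t0 c sg N r Phi).
Proof.
move=> bP; have cm n k l : continuous (fun b => mean b n (fun u => Phi u * ncov (u k) (u l))).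
  by apply: continuous_mean => //; exact: bdd_cov.
move=> x; apply: cvgD; last exact: continuous_scaleR.
apply: cvgB; last by apply: continuous_scaleR; apply: continuous_sumR => l; exact: cm.
by apply: continuous_sumR => k; apply: continuous_sumR => l; exact: cm.
Qed.

Lemma continuous_gg_integrand r Phi : bdd Phi ->
  continuous (gg_integrand t0 c sg N r Phi).
Proof.
move=> bP; have cm n k l : continuous (fun b => mean b n (fun u => Phi u * ncov (u k) (u l))).
  by apply: continuous_mean => //; exact: bdd_cov.
move=> x; apply: cvgD; last first.
  apply: cvgM; first exact: continuous_mean.
  by apply: continuous_mean => //; exact: bdd_fin2.
apply: cvgB; last exact: continuous_scaleR.
by apply: continuous_sumR => k; exact: cm.
Qed.

Lemma continuous_comp_sqrt (f : R -> R) x : continuous f ->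
  {for x, continuous (fun t => f (Num.sqrt t))}.
Proof. by move=> cf; apply: (cvg_comp Num.sqrt f); [exact: sqrt_continuous|exact: cf]. Qed.

Lemma sqrt_sqr_pos (x : R) : 0 < x -> Num.sqrt (x ^+ 2) = x.
Proof. by move=> x0; rewrite sqrtr_sqr gtr0_norm. Qed.

Lemma stab_integral_bound r Phi : depends_below r Phi -> (forall u, `|Phi u| <= 1) ->
  `|\int[mu]_(t in `[b1 ^+ 2, b2 ^+ 2]) stab_integrand t0 c sg N r Phi (Num.sqrt t)| <= 4 / N.
Proof.
move=> dP P1; have bP : bdd Phi by exists 1.
have [A hA] := mean_taylor t0 sg1 N_gt0 ncov_diag dP bP.
have dm x := @is_derive_of_quadratic _ (fun b => mean b r Phi) x _ A (hA x).
(* The chain rule gives [b * N] times the integrand, divided by [2 * b]; the prefactor [2 / N]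
   undoes this. *)
pose U t := 2 / N * mean (Num.sqrt t) r Phi.
have UdU x : b1 ^+ 2 <= x ->
    is_derive x (1 : R) U (stab_integrand t0 c sg N r Phi (Num.sqrt x)).
  move=> /sq_gt0 x0; have ds := is_derive1_sqrt x0.
  have h := is_deriveZ (2 / N) (is_derive1_comp (dm (Num.sqrt x)) ds).
  apply: (is_derive_eq h); rewrite /GRing.scale/=.
  have s0 : Num.sqrt x != 0 by rewrite gt_eqF// sqrtr_gt0.
  by field; rewrite s0 gt_eqF.
rewrite (integral_derive sq12 UdU); last first.
  by move=> x _; apply: continuous_comp_sqrt; exact: continuous_stab_integrand.
have N2 : 0 <= 2 / N by rewrite divr_ge0// ltW.
rewrite /U -mulrBr normrM (ger0_norm N2).
have -> : 4 / N = 2 / N * (1 + 1) by ring.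
apply: ler_wpM2l => //; apply: (le_trans (ler_normB _ _)).
by apply: lerD; exact: ler_norm_mean.
Qed.

(** [gg_integrand_bound] with [la = de^2], and every variance taken at [b2 + 1], which dominates
    [b + de] and [b - de] as [de <= 1]. The increment of [mdpressure] is a derivative in [b], so its
    integral reduces to boundary values of [W]. *)
Lemma gg_integral_bound r Phi (de : R) : depends_below r Phi ->
  (forall u, `|Phi u| <= 1) -> 0 < de -> de <= 1 ->
  `|\int[mu]_(t in `[b1 ^+ 2, b2 ^+ 2]) gg_integrand t0 c sg N r Phi (Num.sqrt t)| <=
  3 * (b2 - b1) * (@gauss_var R * (b2 + 1) ^+ 2 * cbar / N / de ^+ 3 + de)
  + 16 * de * (b2 + 1) * cbar.
Proof.
move=> dP P1 de0 de1; have bP : bdd Phi by exists 1.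
pose P := mpressure c sg N; pose P' := mdpressure c sg N.
pose W b := P (b + de) - P (b - de); pose dW b := P' (b + de) - P' (b - de).
pose v := @gauss_var R * (b2 + 1) ^+ 2 * cbar / N.
(* Three copies of [fluct_bound] at [la = de^2], divided by [de]. *)
pose C := 3 / 2 * (v / de ^+ 3 + de).
have cb0 : 0 <= cbar by exact: (cbar_ge0 t0 sg1 N_gt0 stable).
have dPE x : is_derive x (1 : R) P (P' x) by exact: is_derive_mpressure.
have cP' : continuous P' by exact: continuous_mdpressure.
have shift_derive (e x : R) : is_derive x (1 : R) (fun b => b + e) 1.
  by apply: is_derive_eq; rewrite addr0.
have dWE x : is_derive x (1 : R) W (dW x).
  have h1 := @is_derive1_comp _ P (fun b => b + de) x _ 1 (dPE (x + de)) (shift_derive de x).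
  have h2 := @is_derive1_comp _ P (fun b => b - de) x _ 1 (dPE (x - de)) (shift_derive (- de) x).
  by apply: (is_derive_eq (is_deriveB h1 h2)); rewrite !mulr1.
have cdW : continuous dW.
  move=> x; apply: cvgB.
  - apply: (cvg_comp (fun b => b + de) P'); last exact: cP'.
    by apply: cvgD; [exact: cvg_id|exact: cvg_cst].
  - apply: (cvg_comp (fun b => b - de) P'); last exact: cP'.
    by apply: cvgB; [exact: cvg_id|exact: cvg_cst].
(* In [t = b^2] the majorant carries a factor [1 / b], twice the derivative of the square root;
   hence the factors 2 in the primitive. *)
pose U t := 2 * C * Num.sqrt t + 2 * W (Num.sqrt t).
pose dU t := (C + dW (Num.sqrt t)) / Num.sqrt t.
have UdU x : b1 ^+ 2 <= x -> is_derive x (1 : R) U (dU x).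
  move=> /sq_gt0 x0; have ds := is_derive1_sqrt x0.
  have h1 := is_deriveZ (2 * C) ds.
  have h2 := is_deriveZ 2 (is_derive1_comp (dWE (Num.sqrt x)) ds).
  apply: (is_derive_eq (is_deriveD h1 h2)); rewrite /dU /GRing.scale/=.
  by field; rewrite gt_eqF// sqrtr_gt0.
have cdU x : b1 ^+ 2 <= x -> {for x, continuous dU}.
  move=> /sq_gt0 x0; apply: cvgM.
    by apply: cvgD; [exact: cvg_cst|exact: continuous_comp_sqrt].
  by apply: cvgV; [rewrite gt_eqF// sqrtr_gt0|exact: sqrt_continuous].
have fbound x : `|x| <= b2 + 1 -> fluct_bound N cbar x (de ^+ 2) <= (v / de ^+ 2 + de ^+ 2) / 2.
  move=> xb; rewrite /fluct_bound; apply: ler_wpM2r => //; rewrite lerD2r.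
  apply: ler_wpM2r; first by rewrite invr_ge0 sqr_ge0.
  apply: ler_wpM2r; first by rewrite invr_ge0 ltW.
  apply: ler_wpM2r => //; apply: ler_wpM2l; first exact: gauss_var_ge0.
  rewrite -(real_normK (num_real x)) lerXn2r// nnegrE//.
  by rewrite (le_trans _ xb).
have le_sqrt x : b1 ^+ 2 <= x -> x <= b2 ^+ 2 -> b1 <= Num.sqrt x <= b2.
  move=> h1 h2; rewrite -[X in X <= _ <= _](sqrt_sqr_pos b1_gt0).
  by rewrite -[X in _ <= _ <= X](sqrt_sqr_pos (lt_trans b1_gt0 b12)) !ler_wsqrtr.
have fdU x : b1 ^+ 2 <= x -> x <= b2 ^+ 2 ->
    `|gg_integrand t0 c sg N r Phi (Num.sqrt x)| <= dU x.
  move=> x1 x2; have /andP[s1 s2] := le_sqrt x x1 x2.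
  set b := Num.sqrt x in s1 s2 *.
  have b0 : 0 < b by rewrite (lt_le_trans b1_gt0).
  rewrite /dU -/b ler_pdivlMr// -[X in _ * X](gtr0_norm b0) -normrM mulrC.
  have de20 : 0 < de ^+ 2 by rewrite exprn_gt0.
  have := gg_integrand_bound t0 sg1 N_gt0 ncov_diag stable b dP P1 de0 de20.
  move=> /le_trans; apply; rewrite lerD2r.
  have -> : C = de^-1 * ((v / de ^+ 2 + de ^+ 2) / 2 + (v / de ^+ 2 + de ^+ 2) / 2
     + (v / de ^+ 2 + de ^+ 2) / 2) by rewrite /C; field; rewrite gt_eqF.
  apply: ler_wpM2l; first by rewrite invr_ge0 ltW.
  by apply: lerD; [apply: lerD|]; apply: fbound; rewrite ler_norml; apply/andP; split; lra.
have := integral_derive_bound sq12 UdU cdU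
  (fun x _ => continuous_comp_sqrt (@continuous_gg_integrand r Phi bP)) fdU.
move=> /le_trans; apply.
have b20 : 0 < b2 by exact: lt_trans b1_gt0 b12.
rewrite /U !sqrt_sqr_pos//.
(* By convexity, [W] is at most [2 * de] times a value of [mdpressure]. In [U] it occurs doubled and
   at two end points, which turns this 4 into the final 16. *)
have bW x : 0 < x -> x <= b2 -> `|W x| <= 4 * de * (b2 + 1) * cbar.
  move=> x0 xb; rewrite /W ler_norml.
  have Pb y : `|y| <= b2 + 1 -> `|P' y| <= (b2 + 1) * (cbar + cbar).
    move=> yb; apply: (le_trans (ler_norm_mdpressure t0 sg1 N_gt0 ncov_diag stable y)).
    by rewrite ler_wpM2r// addr_ge0.
  have h1 := mpressure_ge t0 c sg1 N_gt0 (x - de) (x + de).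
  have h2 := mpressure_ge t0 c sg1 N_gt0 (x + de) (x - de).
  have e1 : x + de - (x - de) = 2 * de by ring.
  have e2 : x - de - (x + de) = - (2 * de) by ring.
  rewrite e1 -/P -/P' in h1; rewrite e2 -/P -/P' in h2.
  have : `|x - de| <= b2 + 1 by rewrite ler_norml; apply/andP; split; lra.
  move=> /Pb; have : `|x + de| <= b2 + 1 by rewrite ler_norml; apply/andP; split; lra.
  move=> /Pb; rewrite !ler_norml => /andP[k1 k2] /andP[k3 k4].
  have d20 : 0 <= 2 * de by lra.
  have m1 := ler_wpM2l d20 k2; have m2 := ler_wpM2l d20 k3.
  by apply/andP; split; lra.
have := bW b1 b1_gt0 (ltW b12); have := bW b2 b20 (lexx _).
rewrite !ler_norml => /andP[? ?] /andP[? ?].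
rewrite /C -/v; lra.
Qed.

End limits.

(** * The spin glass *)

Section spin_glass.
Context {R : realType} {d : nat} (Delta : {fset 'rV[int]_d} -> R).
Context (a : 'I_d -> int) (L : 'I_d -> nat).
Notation config := (config L).
Notation sites := {set site L}.

Definition coupling (X : sites) : R := Delta (embX a X).
(** Serves both as the default replica of [rep] and as the base point [t0] of the abstract
    sections. *)
Definition all_up : config := [ffun=> true].
Definition volume : R := #|site L|%:R.
Notation mean := (mean all_up coupling (@sigmaX R d L)).
Notation tilt := (tilt coupling (@sigmaX R d L)).

Lemma ler_norm_sigmaX (X : sites) (s : config) : `|sigmaX X s : R| <= 1.
Proof.
rewrite /sigmaX; case: ifP => _; first by rewrite normr0.
rewrite normr_prod big1// => i _.
by rewrite /spin; case: (s i); rewrite ?normrN normr1.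
Qed.

(** [sigmaX X s] squares to 1 for nonempty [X] and to 0 for the empty set, whatever [s] is; this
    discharges [ncov_diag]. *)
Lemma cov_diag (s : config) : cov a Delta s s = cov a Delta all_up all_up.
Proof.
rewrite /cov; congr (_ * _); apply: eq_bigr => X _; rewrite -!mulrA; congr (_ * _).
have sq (t : config) : sigmaX X t * sigmaX X t = if X == finset.set0 then 0 else 1 :> R.
  rewrite /sigmaX; case: ifP => _; first by rewrite mul0r.
  rewrite -big_split/= big1// => i _.
  by rewrite /spin; case: (t i); rewrite ?mulrNN mulr1.
by rewrite !sq.
Qed.

(** The bridge to the abstract model: the minus sign of the Hamiltonian and that of the Boltzmann
    exponent cancel, leaving [tilt]. *)
Lemma OmegaE n beta g (Phi : (nat -> config) -> R) :
  Omega a Delta beta g (fun ss : {ffun 'I_n -> config} => Phi (rep ss)) =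
  rgib all_up n (tilt beta g) Phi.
Proof.
have tiltE s : - beta * Ham a Delta g s = tilt beta g s by rewrite /Ham mulrNN.
rewrite /Omega /rgib /gib gibZ_energy; congr (_ / _ ^+ _).
  by apply: eq_bigr => ss _; rewrite mulr_sumr (eq_bigr _ (fun i _ => tiltE (ss i))).
by apply: eq_bigr => s _; rewrite tiltE.
Qed.

Definition overlap_obs r (G : 'M[R]_r -> R) (u : nat -> config) : R :=
  G (\matrix_(i < r, j < r) cov a Delta (u i) (u j)).

Lemma overlap_obs_depends r (G : 'M[R]_r -> R) : depends_below r (overlap_obs G).
Proof. by move=> u v uv; congr G; apply/matrixP => i j; rewrite !mxE !uv. Qed.

Lemma qavGqE r (G : 'M[R]_r -> R) k l beta :
  qavGq a L Delta G k l beta =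
  mean beta (maxn r (maxn k.+1 l.+1))
    (fun u => overlap_obs G u * cov a Delta (u k) (u l)).
Proof. by congr Av; apply/funext => g; rewrite -OmegaE. Qed.

(** After the passage to [rgib], only the maxima defining the replica numbers remain to be
    evaluated. *)
Lemma integrand1E r (G : 'M[R]_r -> R) beta : integrand1 a L Delta G beta =
  stab_integrand all_up coupling (@sigmaX R d L) volume r (overlap_obs G) beta.
Proof.
rewrite /integrand1 /stab_integrand; congr (_ - _ * _ + _ * _).
- apply: eq_bigr => k _; apply: eq_bigr => l _; rewrite qavGqE.
  by rewrite (maxn_idPl _)// geq_max !ltn_ord.
- apply: eq_bigr => l _; rewrite qavGqE.
  by rewrite (maxn_idPr (_ : l < r.+1)%N) ?(maxn_idPr (leqnSn r))// ltnW ?ltnS.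
- rewrite qavGqE (maxn_idPr (leqnSn r.+1)) (maxn_idPr _)//.
  by rewrite -addn2 leq_addr.
Qed.

Lemma integrand2E r (G : 'M[R]_r -> R) beta : integrand2 a L Delta G beta =
  gg_integrand all_up coupling (@sigmaX R d L) volume r (overlap_obs G) beta.
Proof.
rewrite /integrand2 /gg_integrand; congr (_ - _ * _ + _ * _).
- apply: eq_bigr => l _; rewrite qavGqE.
  by rewrite (maxn_idPr (_ : l < r.+1)%N) ?(maxn_idPr (leqnSn r))// ltnW ?ltnS.
- rewrite qavGqE (maxn_idPr (leqnSn r.+1)) (maxn_idPr _)//.
  by rewrite -addn2 leq_addr.
- by congr Av; apply/funext => g; rewrite -OmegaE.
- by congr Av; apply/funext => g; rewrite -OmegaE.
Qed.

End spin_glass.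

(** * Passage to the thermodynamic limit *)

Unset Implicit Arguments.

Theorem theorem1 (R : realType) (d : nat) (Delta : {fset 'rV[int]_d} -> R)
  (Htrans : forall (X : {fset 'rV[int]_d}) (b : 'rV[int]_d),
      Delta (translate X b) ^+ 2 = Delta X ^+ 2)
  (Hstab : exists cbar : R, forall (a : 'I_d -> int) (L : 'I_d -> nat),
      (#|site L|%:R)^-1 * \sum_(X : {set site L}) Delta (embX a X) ^+ 2 <= cbar)
  (r : nat) (Hr : (1 <= r)%N) (G : 'M[R]_r -> R)
  (HGsmooth : smooth G) (HGbound : forall M, `|G M| <= 1)
  (b1 b2 : R) (Hb1 : 0 < b1) (Hb12 : b1 < b2) :
  (forall eps : R, 0 < eps -> exists N : nat,
     forall (a : 'I_d -> int) (L : 'I_d -> nat), (N <= #|site L|)%N ->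
       `| \int[@lebesgue_measure R]_(t in `[b1 ^+ 2, b2 ^+ 2])
            integrand1 a L Delta G (Num.sqrt t) | < eps)
  /\
  (forall eps : R, 0 < eps -> exists N : nat,
     forall (a : 'I_d -> int) (L : 'I_d -> nat), (N <= #|site L|)%N ->
       `| \int[@lebesgue_measure R]_(t in `[b1 ^+ 2, b2 ^+ 2])
            integrand2 a L Delta G (Num.sqrt t) | < eps).
Proof.
have [cbar stab] := Hstab.
have arch (x : R) : 0 <= x -> exists n : nat, forall m : nat, (n <= m)%N ->
    0 < m%:R :> R /\ x < m%:R :> R.
  move=> x0; exists (Num.Def.archi_bound x) => m nm.
  have xm : x < m%:R by rewrite (lt_le_trans (archi_boundP x0))// ler_nat.
  by split => //; rewrite (le_lt_trans x0).
split=> eps eps0.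
  have [n nP] := arch (4 / eps) (divr_ge0 (ler0n _ 4) (ltW eps0)).
  exists n => a L /nP[V0 V4].
  under eq_Rintegral do rewrite integrand1E.
  have G1 (u : nat -> config L) : `|overlap_obs Delta a G u| <= 1 by exact: HGbound.
  have h := stab_integral_bound (all_up L) (@ler_norm_sigmaX R d L) V0
    (@cov_diag R d Delta a L) Hb1 Hb12 (overlap_obs_depends Delta a G) G1.
  apply: (le_lt_trans h).
  by rewrite ltr_pdivrMr// -ltr_pdivrMl// mulrC.
have b20 : 0 < b2 by exact: lt_trans Hb1 Hb12.
pose k := @gauss_var R.
have k0 : 0 <= k by exact: gauss_var_ge0.
(* Still a stability constant, and visibly nonnegative. *)
pose c := `|cbar|.
(* The bound equals [B / volume + de * (A - 1)]. The added 1 makes [A] positive; [de] is chosen so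
   that the second term stays below [eps / 2], and the volume is then taken large compared with
   [B]. *)
pose A := 3 * (b2 - b1) + 16 * (b2 + 1) * c + 1.
have A0 : 0 < A.
  have h : 0 <= 16 * (b2 + 1) * c by apply: mulr_ge0; [lra|exact: normr_ge0].
  by rewrite /A; lra.
pose de := Num.min 1 (eps / 2 / A).
have de0 : 0 < de by rewrite lt_min ltr01 !divr_gt0.
have de1 : de <= 1 by rewrite ge_min lexx.
have deA : de * A <= eps / 2 by rewrite -ler_pdivlMr// ge_min lexx orbT.
pose B := 3 * (b2 - b1) * (k * (b2 + 1) ^+ 2 * c / de ^+ 3).
have B0 : 0 <= B.
  have h1 : 0 <= 3 * (b2 - b1) by lra.
  have h2 : 0 <= k * (b2 + 1) ^+ 2 by rewrite mulr_ge0// sqr_ge0.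
  apply: mulr_ge0 => //; apply: divr_ge0; last by rewrite exprn_ge0// ltW.
  by apply: mulr_ge0 => //; exact: normr_ge0.
have [n nP] := arch (B / (eps / 2)) (divr_ge0 B0 (ltW (divr_gt0 eps0 (ltr0n _ 2)))).
exists n => a L /nP[V0 VB].
under eq_Rintegral do rewrite integrand2E.
have stabL : (volume L)^-1 * \sum_(X : {set site L}) coupling Delta a X ^+ 2 <= c.
  exact: (le_trans (stab a L) (ler_norm cbar)).
have G1 (u : nat -> config L) : `|overlap_obs Delta a G u| <= 1 by exact: HGbound.
have h := gg_integral_bound (all_up L) (@ler_norm_sigmaX R d L) V0
  (@cov_diag R d Delta a L) stabL Hb1 Hb12 (overlap_obs_depends Delta a G) G1 de0 de1.
apply: (le_lt_trans h).
have BV : B / volume L < eps / 2.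
  by rewrite ltr_pdivrMr// [ltRHS]mulrC -ltr_pdivrMr ?divr_gt0//; exact: VB.
rewrite -/k.
have -> : 3 * (b2 - b1) * (k * (b2 + 1) ^+ 2 * c / volume L / de ^+ 3 + de)
    + 16 * de * (b2 + 1) * c = B / volume L + (de * A - de).
  rewrite /B /A; field; rewrite !gt_eqF//.
by lra.
Qed.
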